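(* Let $\beta\in[1,2)$ and $\gamma\in(0,2]\setminus\{1\}$. Let $S$ be a random walk on $\mathbb Z$ with i.i.d. symmetric increments in the normal basin of attraction of a $\beta$-stable law, let $(\zeta_k)_{k\in\mathbb Z}$ be i.i.d. positive random variables, independent of $S$, in the normal basin of attraction of a $\gamma$-stable law, let $Y_n=\omega_{S_n}$ be the random walk on the random medium $\omega$ with inter-distances $\zeta_k$, and let $X=(X_t)_{t\ge0}$ be the continuous-time unit-speed interpolation of $Y$. Let $\mathcal T(X)=\inf\{t>0: X_t>0\}$ and $\hat\gamma=\min\{1,\gamma\}$. Then, for all sufficiently large $t$, $$K_{low}(t)\,t^{-\min\{\hat\gamma,\,1/2\}}\le\mathbb P(\mathcal T(X)>t)\le K_{up}(t)\,t^{-\hat\gamma/2},$$ where $K_{low}(t)$ and $K_{up}(t)$ are positive constants if $\gamma\in(1,2]$ and $\beta\ne1$, and suitable slowly varying functions (at infinity) if $\gamma\in(0,1)$ or $\beta=1$.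
   Context: $S_0=0$, $S_n=\sum_{k=1}^n\xi_k$, with $\mathbb E[e^{is\xi_1}]=1-\nu s^\beta+o(s^\beta)$ as $s\to0^+$, $\nu>0$ (normal basin of attraction of a symmetric $\beta$-stable law). The random medium is $\omega_0=0$, $\omega_k-\omega_{k-1}=\zeta_k$ for $k\in\mathbb Z$. The $\zeta_k$ have characteristic function, as $\theta\to0^+$, $1-c\,e^{-i\pi\gamma/2}\theta^\gamma+o(\theta^\gamma)$ with $c>0$ if $\gamma\in(0,1)$; if $\gamma\in(1,2]$ they have finite mean $\mu>0$ and $\zeta_1-\mu$ is in the normal domain of attraction of a $\gamma$-stable law (so the characteristic function is $1+i\mu\theta+o(\theta)$). Collision times: $T_0=0$, $T_n=\sum_{k=1}^n|\omega_{S_k}-\omega_{S_{k-1}}|$. The process $X$ is defined by $X_t=Y_n+\mathrm{sgn}(\xi_{n+1})(t-T_n)$ for $t\in[T_n,T_{n+1})$ (generalized L\'evy-Lorentz gas). *)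

(* Defs.v *)
From HB Require Import structures.
From mathcomp Require Import all_boot all_order all_algebra.
From mathcomp Require Import complex.
From mathcomp Require Import all_classical all_reals all_analysis.
Set Implicit Arguments.
Unset Strict Implicit.
Unset Printing Implicit Defensive.
Import Order.TTheory GRing.Theory Num.Theory.
Import numFieldNormedType.Exports.
Local Open Scope classical_set_scope.
Local Open Scope ring_scope.
Local Open Scope complex_scope.

(* [int] with the discrete sigma-algebra, so that integer-valued random
   variables are [{RV P >-> int}]. *)
HB.instance Definition _ := isPointed.Build int 0.
HB.instance Definition _ := @isMeasurable.Build default_measure_display
  int discrete_measurable discrete_measurable0
  discrete_measurableC discrete_measurableU.

Section paths.
Context {R : realType}.
Implicit Types (x : nat -> int) (z : int -> R).

(* In this section [x n] is the (n+1)-th increment of the walk (increments are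
   usually numbered from 1) and [z k] is the length of the k-th bond,
   i.e. the one between the points k-1 and k of the medium. *)

Definition walk x (n : nat) : int := \sum_(k < n) x k.

Definition medium z (k : int) : R :=
  match k with
  | Posz n => \sum_(j < n) z (Posz j.+1)
  | Negz n => - \sum_(j < n.+1) z (- (Posz j))
  end.

Lemma medium0 z : medium z 0 = 0.
Proof. by rewrite /= big_ord0. Qed.

Lemma mediumB z (k : int) : medium z k - medium z (k - 1) = z k.
Proof.
case: k => [[|n]|n].
- rewrite sub0r medium0 sub0r; change (- 1%:Z) with (Negz 0).
  by rewrite /= big_ord1 opprK.
- have -> : Posz n.+1 - 1 = Posz n by rewrite -addn1 PoszD addrK.
  by rewrite /= big_ord_recr /= addrAC subrr add0r.
- have -> : Negz n - 1 = Negz n.+1 by rewrite !NegzE -opprD -PoszD addn1.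
  rewrite /= [X in _ - - X]big_ord_recr /= opprK addKr.
  by rewrite NegzE.
Qed.

Definition wrm x z (n : nat) : R := medium z (walk x n).

Definition collision_time x z (n : nat) : R :=
  \sum_(k < n) `|wrm x z k.+1 - wrm x z k|.

(* The position at time t. Collision times are nondecreasing, so at most one n
   satisfies the condition below and the value is uniquely determined; times
   beyond all the collision times (which exist only when these are bounded)
   get the default value 0. *)
Definition levy_lorentz x z (t : R) : R :=
  xget 0 [set y | exists n : nat,
    collision_time x z n <= t < collision_time x z n.+1 /\
    y = wrm x z n + (Num.sg (x n))%:~R * (t - collision_time x z n)].

(* +oo when the path never visits the positive half-line at a positive time *)
Definition first_passage_time x z : \bar R :=
  ereal_inf [set t%:E | t in [set t : R | 0 < t /\ 0 < levy_lorentz x z t]].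

End paths.

Section probability.
Context {R : realType} {d : measure_display} {T : measurableType d}.
Variable P : probability T R.

Definition mutually_independent {d'} {T' : measurableType d'} {I : choiceType}
    (X : I -> {RV P >-> T'}) : Prop :=
  forall (s : seq I) (B : I -> set T'), uniq s ->
    (forall i, measurable (B i)) ->
    P (\bigcap_(i in [set` s]) X i @^-1` B i) =
    (\prod_(i <- s) P (X i @^-1` B i))%E.

Definition identically_distributed {d'} {T' : measurableType d'} {I : Type}
    (X : I -> {RV P >-> T'}) : Prop :=
  forall (i j : I) (B : set T'), measurable B ->
    distribution P (X i) B = distribution P (X j) B.

Definition iid {d'} {T' : measurableType d'} {I : choiceType}
    (X : I -> {RV P >-> T'}) : Prop :=
  mutually_independent X /\ identically_distributed X.

Definition generated_sigma_algebra {d'} {T' : measurableType d'} {I : Type}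
    (X : I -> {RV P >-> T'}) : set (set T) :=
  <<s [set A | exists i (B : set T'), measurable B /\ A = X i @^-1` B] >>.

Definition independent_families
    {d1} {T1 : measurableType d1} {I : Type} (X : I -> {RV P >-> T1})
    {d2} {T2 : measurableType d2} {J : Type} (Y : J -> {RV P >-> T2}) : Prop :=
  forall A B : set T,
    generated_sigma_algebra X A -> generated_sigma_algebra Y B ->
    P (A `&` B) = (P A * P B)%E.

Definition symmetric_rv (X : {RV P >-> int}) : Prop :=
  forall k : int, distribution P X [set k] = distribution P X [set - k].

(* the complex number E[exp(i s X)] *)
Definition charfun (X : T -> R) (s : R) : R[i] :=
  fine ('E_P[fun w => cos (s * X w)])%E +i* fine ('E_P[fun w => sin (s * X w)])%E.

(* f s = g s + o(s `^ p) as s -> 0+ *)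
Definition eq_mod_littleo_at0 (f g : R -> R[i]) (p : R) : Prop :=
  ComplexField.Normc.normc (f s - g s) / s `^ p @[s --> 0^'+] --> (0 : R).

Definition cvg_in_distribution (Z : nat -> T -> R) (Q : probability R R) :
    Prop :=
  forall x : R, {for x, continuous (fun y : R => Q `]-oo, y]%classic)} ->
    P [set w | Z n w <= x] @[n --> \oo] --> Q `]-oo, x]%classic.

(* Nondegenerate laws Q such that, for X1, X2, X independent with law Q,
   a X1 + b X2 has the law of (a^g + b^g)^(1/g) X + e for some real e. *)
Definition stable_law (g : R) (Q : probability R R) : Prop :=
  (forall x : R, Q [set x] <> 1%E) /\
  forall a b : R, 0 < a -> 0 < b -> exists e : R,
    forall A : set R, measurable A ->
      (Q \x Q)%E [set p : R * R | A (a * p.1 + b * p.2)] =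
      Q [set x | A ((a `^ g + b `^ g) `^ g^-1 * x + e)].

(* For an i.i.d. sequence X: its common law is in the normal domain of
   attraction of a g-stable law. The usual scale factor in front of n^(1/g) is
   absorbed in the limit law. *)
Definition normal_domain_of_attraction (g : R) (X : nat -> T -> R) : Prop :=
  exists Q : probability R R, stable_law g Q /\
  exists b : nat -> R,
    cvg_in_distribution
      (fun n w => (\sum_(k < n) X k w) / n%:R `^ g^-1 - b n) Q.

(* exp(- i pi g / 2) *)
Definition stable_phase (g : R) : R[i] :=
  cos (pi * g / 2) -i* sin (pi * g / 2).

Definition walk_attraction (beta : R) (X : T -> R) : Prop :=
  exists2 nu : R, 0 < nu &
    eq_mod_littleo_at0 (charfun X) (fun s => 1 - (nu * s `^ beta)%:C) beta.

Definition medium_attraction (gamma : R) (zeta : int -> T -> R) : Prop :=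
  (gamma < 1 -> exists2 c : R, 0 < c &
    eq_mod_littleo_at0 (charfun (zeta 1))
      (fun s => 1 - (c * s `^ gamma)%:C * stable_phase gamma) gamma) /\
  (1 < gamma -> exists2 mu : R, 0 < mu &
    [/\ P.-integrable setT (EFin \o zeta 1),
        ('E_P[zeta 1%R] = mu%:E)%E &
        normal_domain_of_attraction gamma
          (fun k w => zeta (Posz k.+1) w - mu)]).

End probability.

Definition positive_constant {R : realType} (K : R -> R) : Prop :=
  exists2 c : R, 0 < c & forall t, K t = c.

Definition slowly_varying {R : realType} (L : R -> R) : Prop :=
  (exists a : R, (forall x, a <= x -> 0 < L x) /\
                 measurable_fun `[a, +oo[%classic L) /\
  forall l : R, 0 < l -> L (l * x) / L x @[x --> +oo] --> (1 : R).

(* Main.v *)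
(** With N the first time at which the walk S is positive and T_n the collision
    times, the first passage time of X lies between T_(N-1) and T_N.

    Persistence: let u_n and v_n be the probabilities that S_1, ..., S_n are
    all <= 0, resp. all < 0. Splitting at the first time of the maximum, and
    using reversal and symmetry, sum_(k <= n) v_k u_(n-k) = 1. Together with
    u_n P(xi < 0) <= v_(n+1) this forces u_n to be of order n^(-1/2).

    Upper bound: P(N > n) = u_n, and on N <= n the jumps made before N have
    total length > t. As the event that the walk is still nonpositive at time k
    is independent of xi_(k+1), and the medium is independent of the walk,
    Markov's inequality for the truncated jumps bounds that probability by
    (u_0 + ... + u_(n-1)) h(a(t)), with a(t) = E min(1, zeta/t) and
    h(a) = E min(1, a |xi|). Here a(t) = O(t^-ghat), h(a) = O(a) if beta > 1 and
    h(a) = O(a ln(1/a)) if beta = 1; take n = t^ghat.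

    Lower bounds: given that the walk makes m nonzero steps and stays
    nonpositive, the time elapsed exceeds a constant times m with probability at
    least 1/2, whence t^(-1/2); and a first step to the left over a bond longer
    than t has probability at least a constant times t^-gamma if gamma < 1. *)

Require Import Defs.
From mathcomp Require Import all_boot all_order all_algebra.
From mathcomp Require Import all_classical all_reals all_analysis.
From mathcomp Require Import measurable_realfun complex.
From mathcomp Require Import zify ring lra.
Import Order.TTheory GRing.Theory Num.Theory.
Import numFieldNormedType.Exports.
Local Open Scope classical_set_scope.
Local Open Scope ring_scope.
Set Implicit Arguments.
Unset Strict Implicit.
Unset Printing Implicit Defensive.

(** * Deterministic paths *)

Section paths.
Context {R : realType}.
Implicit Types (x : nat -> int) (z : int -> R).

(** No conditional law is formed. The first [n] steps form a value of the countable type [seq int];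
    on a fiber of this list the path is a fixed [y], events about its collision times lie in the
    sigma-algebra of [zeta], and independence gives a product. Summing over fibers replaces
    conditioning. Bonds are positive only almost surely, so inclusions between events are checked on
    [all_pos].

    For the walk, and for the medium if gamma < 1, the characteristic function enters through E(1 -
    cos (s X)), whose integrand is nonnegative, so that Markov's inequality applies. Tails and
    truncated means then follow by doubling the argument; doubling a truncated mean compares 2^p
    with 2, and equality, p = 1, produces the logarithm.

    The choice n = t^ghat balances u_n, of order n^(-1/2), against n^(1/2) t^(-ghat), the order of
    the jump term up to the logarithm.

    A step may be zero, and then no time passes. The lower bound t^(-1/2) therefore counts nonzero
    steps and discards the walks that make few of them; their probability is exponentially small,
    hence negligible against n^(-1/2). *)

Lemma walk0 x : walk x 0 = 0. Proof. by rewrite /walk big_ord0. Qed.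

Lemma walkS x n : walk x n.+1 = walk x n + x n.
Proof. by rewrite /walk big_ord_recr. Qed.

Lemma medium_addn z (k : int) n :
  medium z (k + n%:Z) = medium z k + \sum_(j < n) z (k + j.+1%:Z).
Proof.
elim: n => [|n IH]; first by rewrite addr0 big_ord0 addr0.
rewrite big_ord_recr /= addrA -IH -[in RHS](mediumB z (k + n.+1%:Z)).
by rewrite (_ : k + n.+1%:Z - 1 = k + n%:Z) ?subrKC//; lia.
Qed.

(** Bond [j] joins the sites [j - 1] and [j], so a jump to either side crosses the bonds that follow
    its leftmost site; the minimum lets one formula serve both directions. *)
Lemma medium_jump z (k y : int) :
  `|medium z (k + y) - medium z k| =
  `|\sum_(j < `|y|%N) z (Num.min k (k + y) + j.+1%:Z)|.
Proof.
have [y0|y0] := leP 0 y.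
  rewrite -{1}(gez0_abs y0) medium_addn addrAC subrr add0r.
  by rewrite min_l ?lerDl.
have -> : medium z k = medium z ((k + y) + `|y|%N%:Z) by congr (medium z _); lia.
rewrite distrC medium_addn addrAC subrr add0r.
by rewrite min_r// gerDl ltW.
Qed.

Lemma medium_lt z (k l : int) : (forall j, 0 < z j) -> k < l ->
  medium z k < medium z l.
Proof.
move=> z0 kl; have -> : l = k + `|l - k|%N%:Z by lia.
rewrite medium_addn ltrDl.
have : (0 < `|l - k|%N)%N by lia.
case: (absz _) => // n _; rewrite big_ord_recl/=.
by rewrite ltr_wpDr// sumr_ge0// => i _; exact/ltW.
Qed.

Lemma medium_le z (k l : int) : (forall j, 0 < z j) -> k <= l ->
  medium z k <= medium z l.
Proof.
by move=> z0; rewrite le_eqVlt => /predU1P[->//|/(medium_lt z0)/ltW].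
Qed.

Lemma medium_gt0 z (k : int) : (forall j, 0 < z j) ->
  (0 < medium z k) = (0 < k).
Proof.
move=> z0; apply/idP/idP; last by move=> /(medium_lt z0); rewrite medium0.
by rewrite !ltNge; apply: contra => /(medium_le z0); rewrite medium0.
Qed.

Lemma collision_timeS x z n : collision_time x z n.+1 =
  collision_time x z n + `|wrm x z n.+1 - wrm x z n|.
Proof. by rewrite /collision_time big_ord_recr. Qed.

Lemma collision_time_le x z : {homo collision_time x z : m n / (m <= n)%N >-> m <= n}.
Proof.
by apply: homo_leq => // [|n]; [exact: le_trans|rewrite collision_timeS lerDl].
Qed.

Lemma collision_time_uniq x z m n t :
  collision_time x z m <= t < collision_time x z m.+1 ->
  collision_time x z n <= t < collision_time x z n.+1 -> m = n.
Proof.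
move=> /andP[m1 m2] /andP[n1 n2]; apply/eqP; rewrite eqn_leq.
apply/andP; split; rewrite leqNgt; apply/negP => /(collision_time_le x z) h.
  by have := le_lt_trans (le_trans h m1) n2; rewrite ltxx.
by have := le_lt_trans (le_trans h n1) m2; rewrite ltxx.
Qed.

Lemma levy_lorentzE x z n t :
  collision_time x z n <= t < collision_time x z n.+1 ->
  levy_lorentz x z t =
  wrm x z n + (Num.sg (x n))%:~R * (t - collision_time x z n).
Proof.
move=> ht; rewrite /levy_lorentz; apply: xget_unique; first by exists n.
by move=> y [m [hm ->]]; rewrite (collision_time_uniq hm ht).
Qed.

(** The default value 0 of [xget] is not positive, so a positive value always comes from an actual
    index [n]. *)
Lemma levy_lorentz_gt0P x z t : 0 < levy_lorentz x z t <->
  exists n, collision_time x z n <= t < collision_time x z n.+1 /\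
    0 < wrm x z n + (Num.sg (x n))%:~R * (t - collision_time x z n).
Proof.
split; last by case=> n [h1 h2]; rewrite (levy_lorentzE h1).
rewrite {1}/levy_lorentz; case: xgetP; last by rewrite ltxx.
by move=> y _ [n [h ->]]; exists n.
Qed.

Definition nonpos_upto x n := [forall k : 'I_n.+1, walk x k <= 0].

Lemma nonpos_uptoP x n :
  reflect (forall k, (k <= n)%N -> walk x k <= 0) (nonpos_upto x n).
Proof.
apply: (iffP forallP) => [h k kn|h k]; last by apply: h; rewrite -ltnS.
by have := h (Ordinal (kn : (k < n.+1)%N)).
Qed.

Lemma nonpos_upto_le x m n : (m <= n)%N -> nonpos_upto x n -> nonpos_upto x m.
Proof.
by move=> mn /nonpos_uptoP h; apply/nonpos_uptoP => k /leq_trans/(_ mn)/h.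
Qed.

(** Before [collision_time x z n] the particle is inside a jump [k < n] whose two ends are
    nonpositive, and the interpolation between them cannot be positive. *)
Lemma first_passage_time_gt x z t n : (forall j, 0 < z j) ->
  nonpos_upto x n -> t < collision_time x z n ->
  (t%:E < first_passage_time x z)%E.
Proof.
move=> z0 /nonpos_uptoP xn /[dup] tT; rewrite -lte_fin => /lt_le_trans; apply.
apply: le_ereal_inf_tmp => _ [s [s0 +] <-]; rewrite lee_fin.
move=> /levy_lorentz_gt0P[k [/andP[k1 k2]]]; rewrite leNgt.
move=> hp; apply/negP => sT; move: hp; apply/negP; rewrite -leNgt.
have kn : (k < n)%N.
  rewrite ltnNge; apply/negP => /(collision_time_le x z) h.
  by have := le_lt_trans (le_trans h k1) sT; rewrite ltxx.
have wk : wrm x z k <= 0.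
  by rewrite leNgt /wrm medium_gt0// -leNgt xn// ltnW.
have wk1 : wrm x z k.+1 <= 0 by rewrite leNgt /wrm medium_gt0// -leNgt xn.
have [x0|x0|x0] := ltgtP (x k) 0.
- rewrite ltr0_sg// mulN1r; move: wk k1; lra.
- have wlt : wrm x z k < wrm x z k.+1.
    by apply: medium_lt => //; rewrite walkS ltrDl.
  move: k2; rewrite gtr0_sg// mul1r collision_timeS gtr0_norm ?subr_gt0//.
  move: wk1; lra.
- by rewrite x0 sgr0 mul0r addr0.
Qed.

Lemma first_passage_time_le x z n : (forall j, 0 < z j) ->
  nonpos_upto x n -> 0 < walk x n.+1 ->
  (first_passage_time x z <= (collision_time x z n.+1)%:E)%E.
Proof.
move=> z0 /nonpos_uptoP/(_ n (leqnn n)) w0 w1.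
have y1 : 0 < wrm x z n.+1 by rewrite /wrm medium_gt0.
have y0 : wrm x z n <= 0 by rewrite leNgt /wrm medium_gt0// -leNgt.
have T0 : 0 <= collision_time x z n by apply: sumr_ge0.
(* At this time the particle is half-way between the origin and its next collision point: positive,
   and still inside jump [n], so the value can be read off with index [n]. *)
pose s := collision_time x z n.+1 - wrm x z n.+1 / 2.
have Tn : collision_time x z n.+1 =
    collision_time x z n + (wrm x z n.+1 - wrm x z n).
  by rewrite collision_timeS gtr0_norm// subr_gt0 (le_lt_trans y0).
apply: (@le_trans _ _ s%:E); last by rewrite lee_fin /s; move: y1; lra.
apply: ereal_inf_lbound; exists s => //; split.
  by rewrite /s Tn; move: y0 y1 T0; lra.
apply/levy_lorentz_gt0P; exists n; split; first by rewrite /s Tn; move: y0 y1 T0; lra.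
rewrite gtr0_sg; last by move: w0 w1; rewrite walkS; lia.
by rewrite /s Tn mul1r; move: y0 y1 T0; lra.
Qed.

(** The jumps made before the walk turns positive are those with [nonpos_upto x k]. This condition
    involves only the steps before [k], which later makes it independent of the length of jump
    [k]. *)
Lemma first_passage_time_cases x z n t : (forall j, 0 < z j) ->
  (t%:E < first_passage_time x z)%E ->
  nonpos_upto x n \/
  t < \sum_(k < n | nonpos_upto x k) `|wrm x z k.+1 - wrm x z k|.
Proof.
move=> z0 ht; have [|/negP xn] := boolP (nonpos_upto x n); [by left|right].
have x0 : nonpos_upto x 0.
  by apply/nonpos_uptoP => k; rewrite leqn0 => /eqP ->; rewrite walk0.
have [m [mn xm xm1]] : exists m, [/\ (m < n)%N, nonpos_upto x m & ~ nonpos_upto x m.+1].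
  elim: n xn => [|n IH] xn; first by rewrite x0 in xn.
  have [h|/negP h] := boolP (nonpos_upto x n); first by exists n.
  by have [m [mn h1 h2]] := IH h; exists m; split => //; exact: ltnW.
have w1 : 0 < walk x m.+1.
  rewrite ltNge; apply/negP => w; apply: xm1; apply/nonpos_uptoP => k.
  by rewrite leq_eqVlt => /predU1P[->//|]; rewrite ltnS; move/nonpos_uptoP : xm; apply.
have := lt_le_trans ht (first_passage_time_le z0 xm w1); rewrite lte_fin.
move=> /lt_le_trans; apply; rewrite /collision_time.
rewrite (big_ord_widen n (fun k => `|wrm x z k.+1 - wrm x z k|))//.
rewrite [leLHS]big_mkcond [leRHS]big_mkcond; apply: ler_sum => k _.
case: ifPn => [km|_]; last by case: ifP.
by rewrite (nonpos_upto_le _ xm).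
Qed.

End paths.
(** * Countably valued random variables *)

Section countable_fibers.
Context {K : countType}.

Definition measurable_fibers d (T : measurableType d) (F : T -> K) :=
  forall k, measurable (F @^-1` [set k]).

(** The fibers are numbered by [pickle] so that countable additivity along [nat] applies; a number
    that codes no element gives an empty piece. *)
Definition piece (T : Type) (F : T -> K) (A : set T) (n : nat) :=
  A `&` [set w | pickle (F w) = n].

Lemma piece_bigcup (T : Type) (F : T -> K) A : \bigcup_n piece F A n = A.
Proof.
by apply/seteqP; split=> [w [n _ []//]|w Aw]; exists (pickle (F w)).
Qed.

Lemma piece_trivIset (T : Type) (F : T -> K) A : trivIset setT (piece F A).
Proof.
apply/trivIsetP => m n _ _ /eqP mn; apply/seteqP; split=> w //=.
by case=> -[_ /= em] [_ /= en]; apply: mn; rewrite -em -en.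
Qed.

Lemma piece_pickle (T : Type) (F : T -> K) A k :
  piece F A (pickle k) = A `&` F @^-1` [set k].
Proof.
apply/seteqP; split=> w [Aw] /= Fw; split=> //=; last by rewrite Fw.
exact: (pcan_inj (@pickleK _)) Fw.
Qed.

Lemma piece0 (T : Type) (F : T -> K) A n :
  ~ (exists k : K, pickle k = n) -> piece F A n = set0.
Proof.
by move=> h; apply/seteqP; split=> w // [_ Fw]; apply: h; exists (F w).
Qed.

Section one_space.
Context d (T : measurableType d) (F : T -> K) (mF : measurable_fibers F).

Lemma measurable_piece A n : measurable A -> measurable (piece F A n).
Proof.
move=> mA; have [[k <-]|h] := pselect (exists k : K, pickle k = n).
  by rewrite piece_pickle; exact: measurableI.
by rewrite piece0.
Qed.

Lemma measurable_preimage_countable (B : set K) : measurable (F @^-1` B).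
Proof.
rewrite (_ : F @^-1` B =
  \bigcup_(n in [set n | exists2 k, B k & pickle k = n]) piece F setT n).
  by apply: bigcup_measurable => n _; exact: measurable_piece.
apply/seteqP; split=> [w Bw|w [n [k Bk <-]]].
  by exists (pickle (F w)) => //; exists (F w).
by rewrite piece_pickle => -[_ Fw]; rewrite /preimage /= Fw.
Qed.

Lemma measure_pieces (R : realType) (mu : {measure set T -> \bar R}) A :
  measurable A -> mu A = (\sum_(n <oo) mu (piece F A n))%E.
Proof.
move=> mA; rewrite -[in LHS](piece_bigcup F A) measure_semi_bigcup//.
- by move=> n; exact: measurable_piece.
- exact: piece_trivIset.
- by rewrite piece_bigcup.
Qed.

(** Stands in for conditioning on [F]: a comparison that holds on each fiber can be summed. *)
Lemma le_integral_fibers (R : realType) (mu : {measure set T -> \bar R}) A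
    (h : T -> \bar R) : measurable A -> measurable_fun setT h ->
  (forall w, 0 <= h w)%E ->
  (forall k, mu (A `&` F @^-1` [set k]) <= \int[mu]_(w in F @^-1` [set k]) h w)%E ->
  (mu A <= \int[mu]_w h w)%E.
Proof.
move=> mA mh h0 le; rewrite (measure_pieces _ mA).
rewrite -[X in (\int[mu]_(_ in X) _)%E](piece_bigcup F setT).
rewrite ge0_integral_bigcup//; first last.
- exact: piece_trivIset.
- by rewrite piece_bigcup.
- by move=> n; exact: measurable_piece.
apply: lee_nneseries => // n _.
have [[k <-]|hn] := pselect (exists k : K, pickle k = n).
  by rewrite !piece_pickle setTI; exact: le.
by rewrite !piece0// measure0 integral_set0.
Qed.

End one_space.

Section two_spaces.
Context d (T : measurableType d) d' (T' : measurableType d') (R : realType).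
Context (mu : {measure set T -> \bar R}) (nu : {measure set T' -> \bar R}).
Context (F : T -> K) (G : T' -> K).
Hypotheses (mF : measurable_fibers F) (mG : measurable_fibers G).

Lemma eq_measure_fibers (c : R) A B : measurable A -> measurable B ->
  (forall k, mu (A `&` F @^-1` [set k]) =
     c%:E * nu (B `&` G @^-1` [set k]))%E -> mu A = (c%:E * nu B)%E.
Proof.
move=> mA mB h; rewrite (measure_pieces mF _ mA) (measure_pieces mG _ mB).
rewrite -nneseriesZl//; apply: eq_eseriesr => n _.
have [[k <-]|hn] := pselect (exists k : K, pickle k = n).
  by rewrite !piece_pickle h.
by rewrite !piece0// !measure0 mule0.
Qed.

Lemma le_measure_fibers (c : R) A B : measurable A -> measurable B ->
  (forall k, mu (A `&` F @^-1` [set k]) <=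
     c%:E * nu (B `&` G @^-1` [set k]))%E -> (mu A <= c%:E * nu B)%E.
Proof.
move=> mA mB h; rewrite (measure_pieces mF _ mA) (measure_pieces mG _ mB).
rewrite -nneseriesZl//; apply: lee_nneseries => // n _.
have [[k <-]|hn] := pselect (exists k : K, pickle k = n).
  by rewrite !piece_pickle h.
by rewrite !piece0// !measure0 mule0.
Qed.

End two_spaces.
End countable_fibers.

(** * Real-valued probabilities, and independence and equality of law tested on fibers *)

Section real_probability.
Context d (T : measurableType d) (R : realType) (P : probability T R).

Definition pr (A : set T) : R := fine (P A).

Lemma prE A : measurable A -> P A = (pr A)%:E.
Proof. by move=> mA; rewrite fineK// fin_num_measure. Qed.

Lemma pr_ge0 A : 0 <= pr A. Proof. exact: fine_ge0. Qed.

Lemma pr_le1 A : measurable A -> pr A <= 1.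
Proof. by move=> mA; rewrite -lee_fin -prE// probability_le1. Qed.

Lemma pr_setT : pr setT = 1.
Proof. by rewrite /pr probability_setT. Qed.

Lemma le_pr A B : measurable A -> measurable B -> A `<=` B -> pr A <= pr B.
Proof. by move=> mA mB AB; rewrite -lee_fin -!prE// le_measure ?inE. Qed.

Lemma pr_setU A B : measurable A -> measurable B -> pr (A `|` B) <= pr A + pr B.
Proof.
move=> mA mB; rewrite -lee_fin EFinD -!prE//; last exact: measurableU.
exact: (measureU2 _ mA mB).
Qed.

Lemma pr_setC A : measurable A -> pr (~` A) = 1 - pr A.
Proof.
move=> mA; apply: EFin_inj; rewrite EFinB -!prE//; last exact: measurableC.
exact: probability_setC.
Qed.

Section fibers.
Context (K : countType) (F : T -> K) (mF : measurable_fibers F).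

Lemma indep_fibers E : measurable E ->
  (forall k, pr (F @^-1` [set k] `&` E) = pr (F @^-1` [set k]) * pr E) ->
  forall B, pr (F @^-1` B `&` E) = pr (F @^-1` B) * pr E.
Proof.
move=> mE h B; have mFB := measurable_preimage_countable mF.
apply: EFin_inj; rewrite mulrC EFinM -(prE (mFB B)) -prE; last exact: measurableI.
apply: (eq_measure_fibers mF mF) => [| |k]//.
  exact: measurableI.
have [Bk|Bk] := pselect (B k); last first.
  rewrite setIAC (_ : F @^-1` B `&` _ = set0) ?set0I ?measure0 ?mule0//.
  by apply/seteqP; split=> w //= [Bw e]; apply: Bk; rewrite -e.
rewrite setIAC (_ : F @^-1` B `&` _ = F @^-1` [set k]); last first.
  apply/seteqP; split=> w /=; first by case.
  by move=> e; split=> //; rewrite /preimage /= e.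
suff : P (F @^-1` [set k] `&` E) = ((pr E)%:E * P (F @^-1` [set k]))%E by [].
by rewrite !prE ?h ?EFinM 1?muleC//; exact: measurableI.
Qed.

End fibers.

Lemma eq_law (K : countType) (F G : T -> K) : measurable_fibers F ->
    measurable_fibers G ->
  (forall k, pr (F @^-1` [set k]) = pr (G @^-1` [set k])) ->
  forall B, pr (F @^-1` B) = pr (G @^-1` B).
Proof.
move=> mF mG h B.
have mFB := measurable_preimage_countable mF.
have mGB := measurable_preimage_countable mG.
apply: EFin_inj; rewrite -!prE// -[RHS]mul1e.
apply: (eq_measure_fibers mF mG) => [| |k]//; rewrite mul1e.
have [Bk|Bk] := pselect (B k); last first.
  rewrite (_ : F @^-1` B `&` _ = set0); last first.
    by apply/seteqP; split=> w //= [Bw e]; apply: Bk; rewrite -e.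
  rewrite (_ : G @^-1` B `&` _ = set0) ?measure0//.
  by apply/seteqP; split=> w //= [Bw e]; apply: Bk; rewrite -e.
rewrite (_ : F @^-1` B `&` _ = F @^-1` [set k]); last first.
  apply/seteqP; split=> w /=; first by case.
  by move=> e; split=> //; rewrite /preimage /= e.
rewrite (_ : G @^-1` B `&` _ = G @^-1` [set k]); last first.
  apply/seteqP; split=> w /=; first by case.
  by move=> e; split=> //; rewrite /preimage /= e.
suff : P (F @^-1` [set k]) = P (G @^-1` [set k]) by [].
by rewrite !prE// h.
Qed.

End real_probability.

(** * Joint law of finitely many steps *)

Section steps.

(** The list of times [s] is arbitrary, so that initial segments, shifted segments, single times and
    reversed segments of the walk are all instances. *)
Definition steps T (X : nat -> T -> int) (s : seq nat) (w : T) : seq int :=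
  [seq X k w | k <- s].

Lemma measurable_steps d (T : measurableType d) (X : nat -> T -> int) s :
  (forall k, measurable_fibers (X k)) -> measurable_fibers (steps X s).
Proof.
move=> mX; elim: s => [|k s IH] [|a l].
- rewrite (_ : _ @^-1` _ = setT)//; exact/seteqP.
- by rewrite (_ : _ @^-1` _ = set0)//; apply/seteqP; split.
- by rewrite (_ : _ @^-1` _ = set0)//; apply/seteqP; split.
rewrite (_ : _ @^-1` _ = X k @^-1` [set a] `&` steps X s @^-1` [set l]).
  by apply: measurableI; [exact: mX|exact: IH].
by apply/seteqP; split=> w /= [-> ->].
Qed.

Context d (T : measurableType d) (R : realType) (P : probability T R).
Context (xi : nat -> {RV P >-> int}) (xi_iid : iid xi).

Local Notation p := (pr P).
Local Notation X := (fun k w => xi k w).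

Lemma measurable_fibers_xi k : measurable_fibers (xi k).
Proof. by move=> a; apply: measurable_funPTI. Qed.

Let mS s := measurable_steps s measurable_fibers_xi.

(** The right-hand side does not involve [s]. Invariance under shift and reversal ([steps_law]) and
    factorisation over disjoint times ([steps_indep]) both come from this. *)
Lemma pr_steps_eq s l : uniq s -> size s = size l ->
  p (steps xi s @^-1` [set l]) = \prod_(a <- l) p (xi 0%N @^-1` [set a]).
Proof.
move=> us sz; have [ind idd] := xi_iid.
apply: EFin_inj; rewrite -prE; last exact: mS.
have -> : steps xi s @^-1` [set l] =
    \bigcap_(i in [set` s]) xi i @^-1` [set nth 0 l (index i s)].
  apply/seteqP; split=> w /=.
    by move=> <- i /= si; rewrite /steps (nth_map 0%N) ?index_mem// nth_index.
  move=> h; apply: (@eq_from_nth _ 0); rewrite size_map// => i si.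
  rewrite (nth_map 0%N)//; have /= -> := h _ (mem_nth 0%N si).
  by rewrite index_uniq.
rewrite ind// -prodEFin (big_nth 0%N) [RHS](big_nth 0) -sz.
apply: eq_big_nat => i /andP[_ si].
rewrite index_uniq// -prE; last exact: measurable_fibers_xi.
by apply: idd.
Qed.

Lemma pr_steps_size s l : size s <> size l ->
  p (steps xi s @^-1` [set l]) = 0.
Proof.
move=> sz; rewrite (_ : _ @^-1` _ = set0) /pr ?measure0//.
by apply/seteqP; split=> w //= h; apply: sz; rewrite -h size_map.
Qed.

Lemma steps_law s s' B : uniq s -> uniq s' -> size s = size s' ->
  p (steps xi s @^-1` B) = p (steps xi s' @^-1` B).
Proof.
move=> us us' ss; apply: (eq_law (mS s) (mS s')) => l.
have [sl|/eqP sl] := eqVneq (size s) (size l); first by rewrite !pr_steps_eq// -ss.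
by rewrite !pr_steps_size// -ss.
Qed.

Lemma steps_indep s s' B B' : uniq (s ++ s') ->
  p (steps xi s @^-1` B `&` steps xi s' @^-1` B') =
  p (steps xi s @^-1` B) * p (steps xi s' @^-1` B').
Proof.
move=> us; have : uniq s /\ uniq s' by move: us; rewrite cat_uniq => /and3P[].
move=> [us1 us2].
apply: (indep_fibers (mS s)) => [|l]; first exact: (measurable_preimage_countable (mS s')).
rewrite setIC mulrC; apply: (indep_fibers (mS s')) => [|l']; first exact: mS.
have [sl|/eqP sl] := eqVneq (size s) (size l); last first.
  rewrite (pr_steps_size sl) mulr0 (_ : _ `&` _ = set0) /pr ?measure0//.
  by apply/seteqP; split=> w //= [_ h]; apply: sl; rewrite -h size_map.
have [sl'|/eqP sl'] := eqVneq (size s') (size l'); last first.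
  rewrite (pr_steps_size sl') mul0r (_ : _ `&` _ = set0) /pr ?measure0//.
  by apply/seteqP; split=> w //= [h _]; apply: sl'; rewrite -h size_map.
rewrite (_ : _ `&` _ = steps xi (s ++ s') @^-1` [set l ++ l']).
  by rewrite !pr_steps_eq ?size_cat ?sl ?sl'// big_cat/= mulrC.
apply/seteqP; split=> w /=; first by rewrite /steps map_cat => -[-> ->].
rewrite /steps map_cat => /eqP; rewrite eqseq_cat ?size_map//.
by move=> /andP[/eqP -> /eqP ->].
Qed.

Lemma steps_oppr_law (xi_sym : symmetric_rv (xi 0%N)) s B : uniq s ->
  p (steps (fun k w => - xi k w) s @^-1` B) = p (steps xi s @^-1` B).
Proof.
move=> us; apply: (eq_law _ (mS s)) => [|l].
  apply: measurable_steps => k a.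
  exact: (measurable_preimage_countable (measurable_fibers_xi k) [set b | - b = a]).
rewrite (_ : _ @^-1` _ = steps xi s @^-1` [set map -%R l]); last first.
  apply/seteqP; split=> w; rewrite /steps /=.
    by move=> <-; rewrite -map_comp; apply: eq_map => k /=; rewrite opprK.
  move=> h; rewrite -[l](mapK (@opprK _)) -h -map_comp; exact: eq_map.
have [sl|/eqP sl] := eqVneq (size s) (size l); last first.
  by rewrite !pr_steps_size// size_map.
rewrite !pr_steps_eq ?size_map// big_map; apply: eq_bigr => a _.
have := xi_sym a; rewrite /distribution /pushforward /pr => <-.
by congr (fine (P _)).
Qed.

End steps.
(** * Persistence of the walk *)

Section walk_events.

Lemma walk_eq (x y : nat -> int) n k : (k <= n)%N ->
  (forall i, (i < n)%N -> x i = y i) -> walk x k = walk y k.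
Proof.
by move=> kn xy; apply: eq_bigr => i _; apply: xy; exact: leq_trans kn.
Qed.

Lemma nonpos_upto_eq (x y : nat -> int) n :
  (forall i, (i < n)%N -> x i = y i) -> nonpos_upto x n = nonpos_upto y n.
Proof.
by move=> xy; apply: eq_forallb => k; rewrite (@walk_eq x y n)// -ltnS.
Qed.

Lemma walkD (x : nat -> int) m k :
  walk x (m + k) = walk x m + walk (fun i => x (m + i)%N) k.
Proof. by rewrite /walk big_split_ord. Qed.

Lemma walkN (x : nat -> int) k : walk (fun i => - x i) k = - walk x k.
Proof. by rewrite /walk sumrN. Qed.

Lemma nth_steps T (X : nat -> T -> int) m n w i : (i < n)%N ->
  nth 0 (steps X (iota m n) w) i = X (m + i)%N w.
Proof.
by move=> i_n; rewrite /steps (nth_map 0%N) ?size_iota// nth_iota.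
Qed.

(** Duality: through it, the statement that time [n] is a strict record becomes positivity of the
    reversed walk. *)
Lemma walk_rev_steps T (X : nat -> T -> int) n w j : (j <= n)%N ->
  walk (nth 0 (steps X (rev (iota 0 n)) w)) j =
  walk (X ^~ w) n - walk (X ^~ w) (n - j).
Proof.
elim: j => [|j IH] jn; first by rewrite walk0 subn0 subrr.
rewrite walkS IH ?(ltnW jn)// /steps map_rev nth_rev ?size_map ?size_iota//.
rewrite (nth_map 0%N) ?size_iota; last lia.
rewrite nth_iota; last lia.
rewrite add0n (_ : (n - j = (n - j.+1).+1)%N); last lia.
by rewrite walkS; lia.
Qed.

Definition neg_upto (x : nat -> int) n := forall k, (0 < k <= n)%N -> walk x k < 0.

Context d (T : measurableType d) (R : realType) (P : probability T R).
Context (xi : nat -> {RV P >-> int}) (xi_iid : iid xi).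
Local Notation p := (pr P).

Let mS s := measurable_steps s (measurable_fibers_xi xi).
Let mSB s B := measurable_preimage_countable (mS s) B.

Definition pr_nonpos n : R := p [set w | nonpos_upto (fun k => xi k w) n].
Definition pr_neg n : R := p [set w | neg_upto (fun k => xi k w) n].

Lemma nonpos_upto_steps m n :
  [set w | nonpos_upto (fun k => xi (m + k)%N w) n] =
  steps xi (iota m n) @^-1` [set l | nonpos_upto (nth 0 l) n].
Proof.
apply/seteqP; split=> w /=; rewrite (@nonpos_upto_eq _ (fun k => xi (m + k)%N w))//.
  by move=> i i_n; rewrite nth_steps.
by move=> i i_n; rewrite nth_steps.
Qed.

Lemma measurable_nonpos_upto m n :
  measurable [set w | nonpos_upto (fun k => xi (m + k)%N w) n].
Proof. by rewrite nonpos_upto_steps; exact: mSB. Qed.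

Lemma pr_nonpos_shift m n :
  p [set w | nonpos_upto (fun k => xi (m + k)%N w) n] = pr_nonpos n.
Proof.
rewrite /pr_nonpos nonpos_upto_steps (nonpos_upto_steps 0).
by apply: steps_law; rewrite ?iota_uniq ?size_iota.
Qed.

Lemma neg_upto_steps n : [set w | neg_upto (fun k => xi k w) n] =
  steps xi (iota 0 n) @^-1` [set l | neg_upto (nth 0 l) n].
Proof.
have e w k : (k <= n)%N ->
    walk (nth 0 (steps xi (iota 0 n) w)) k = walk (fun k => xi k w) k.
  by move=> kn; apply: (walk_eq kn) => i i_n; rewrite nth_steps.
apply/seteqP; split=> w /= h k kn.
  by rewrite e ?h//; case/andP: kn.
by rewrite -e ?h//; case/andP: kn.
Qed.

Lemma measurable_neg_upto n : measurable [set w | neg_upto (fun k => xi k w) n].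
Proof. by rewrite neg_upto_steps; exact: mSB. Qed.

Lemma pr_neg_le_nonpos n : pr_neg n <= pr_nonpos n.
Proof.
apply: le_pr; [exact: measurable_neg_upto|exact: (measurable_nonpos_upto 0)|].
move=> w /= h; apply/nonpos_uptoP => -[|k] kn; first by rewrite walk0.
by apply/ltW/h.
Qed.

Lemma pr_nonpos_nincr m n : (m <= n)%N -> pr_nonpos n <= pr_nonpos m.
Proof.
move=> mn; apply: le_pr; do ?exact: (measurable_nonpos_upto 0).
by move=> w /=; exact: nonpos_upto_le.
Qed.

Lemma pr_neg_nincr m n : (m <= n)%N -> pr_neg n <= pr_neg m.
Proof.
move=> mn; apply: le_pr; do ?exact: measurable_neg_upto.
by move=> w /= h k /andP[k0 km]; apply: h; rewrite k0 (leq_trans km).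
Qed.

(** After a first step to the left, a remaining walk that stays [<= 0] relative to its start keeps
    the whole walk [< 0]. *)
Lemma pr_nonpos_first_step n :
  p (xi 0%N @^-1` [set k | k < 0]) * pr_nonpos n <= pr_neg n.+1.
Proof.
rewrite -(pr_nonpos_shift 1) nonpos_upto_steps.
have e : xi 0%N @^-1` [set k | k < 0] =
    steps xi [:: 0%N] @^-1` [set l | nth 0 l 0%N < 0] by [].
rewrite e -steps_indep//; last by rewrite /= mem_iota iota_uniq.
rewrite -e -nonpos_upto_steps; apply: le_pr.
- apply: measurableI; last exact: measurable_nonpos_upto.
  exact: (measurable_preimage_countable (measurable_fibers_xi xi 0)).
- exact: measurable_neg_upto.
move=> w [/= x0 /nonpos_uptoP h] [//|k] /andP[_ kn].
by rewrite (walkD _ 1) walkS walk0 add0r ltr_wnDr// h.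
Qed.

Hypothesis xi_sym : symmetric_rv (xi 0%N).

(** Strict before [k] and weak after it: this singles out one maximiser, and it is why one factor
    below is [pr_neg] and the other [pr_nonpos]. *)
Definition first_max n k w := (forall j, (j < k)%N ->
    walk (fun i => xi i w) j < walk (fun i => xi i w) k) /\
  (forall j, (k <= j <= n)%N ->
    walk (fun i => xi i w) j <= walk (fun i => xi i w) k).

Let Pos k : set (seq int) :=
  [set l | forall j, (0 < j <= k)%N -> 0 < walk (nth 0 l) j].

Lemma first_max_steps n k : (k <= n)%N -> [set w | first_max n k w] =
  steps xi (rev (iota 0 k)) @^-1` Pos k `&`
  steps xi (iota k (n - k)) @^-1` [set l | nonpos_upto (nth 0 l) (n - k)].
Proof.
move=> kn; rewrite -nonpos_upto_steps; apply/seteqP; split=> w /= -[h1 h2]; split.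
- move=> j /andP[j0 jk]; rewrite walk_rev_steps// subr_gt0; apply: h1; lia.
- apply/nonpos_uptoP => j jnk; rewrite -(lerD2l (walk (fun i => xi i w) k)).
  by rewrite -walkD addr0; apply: h2; lia.
- move=> j jk; have := h1 (k - j)%N; rewrite walk_rev_steps ?leq_subr//.
  by rewrite subKn ?(ltnW jk)// subr_gt0; apply; lia.
- move=> j /andP[kj jn]; have /nonpos_uptoP/(_ (j - k)%N) := h2.
  rewrite -(lerD2l (walk (fun i => xi i w) k)) -walkD addr0 subnKC//; apply; lia.
Qed.

Lemma pr_first_max n k : (k <= n)%N ->
  p [set w | first_max n k w] = pr_neg k * pr_nonpos (n - k).
Proof.
move=> kn; rewrite first_max_steps// steps_indep//; last first.
  rewrite cat_uniq rev_uniq !iota_uniq andbT/=; apply/hasPn => i.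
  by rewrite mem_rev !mem_iota; lia.
rewrite -nonpos_upto_steps pr_nonpos_shift; congr (_ * _).
(* Reversal keeps the law of the first [k] steps; the sign change that follows turns positivity into
   negativity. *)
rewrite (@steps_law _ _ _ _ _ xi_iid _ (iota 0 k)) ?rev_uniq ?iota_uniq ?size_rev//.
rewrite -steps_oppr_law ?iota_uniq// /pr_neg; congr (pr P _).
have e w j : (j <= k)%N -> walk (nth 0 (steps (fun i w => - xi i w) (iota 0 k) w)) j
    = - walk (fun i => xi i w) j.
  by move=> jk; rewrite -walkN; apply: (walk_eq jk) => i ik; rewrite nth_steps.
apply/seteqP; split=> w /= h j jk; have := h _ jk;
  by rewrite e ?oppr_gt0//; case/andP: jk.
Qed.

Lemma measurable_first_max n k : (k <= n)%N -> measurable [set w | first_max n k w].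
Proof. by move=> kn; rewrite first_max_steps//; apply: measurableI; exact: mSB. Qed.

Lemma first_max_exists n w : exists2 k, (k <= n)%N & first_max n k w.
Proof.
pose s := walk (fun i => xi i w).
pose Q k := (k <= n)%N && [forall j : 'I_n.+1, s j <= s k].
have exQ : exists k, Q k.
  case: (@arg_maxP _ _ _ (@ord0 n) xpredT (fun i : 'I_n.+1 => s i)) => // i _ h.
  by exists i; rewrite /Q -ltnS ltn_ord; apply/forallP => j; exact: h.
case: (ex_minnP exQ) => k /andP[kn /forallP hk] mink; exists k => //; split.
  move=> j jk; rewrite lt_neqAle; have jn : (j < n.+1)%N by lia.
  have /= -> := hk (Ordinal jn); rewrite andbT; apply/negP => /eqP e.
  have : Q j by rewrite /Q -ltnS jn; apply/forallP => i; rewrite [s j]e.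
  by move=> /mink; rewrite leqNgt jk.
by move=> j /andP[_ jn]; exact: (hk (Ordinal (jn : (j < n.+1)%N))).
Qed.

Lemma first_max_uniq n k k' w : (k <= n)%N -> (k' <= n)%N ->
  first_max n k w -> first_max n k' w -> k = k'.
Proof.
move=> kn kn' [h1 h2] [h1' h2']; apply/eqP; rewrite eqn_leq.
by apply/andP; split; rewrite leqNgt; apply/negP => lt;
  [have := h1 _ lt; have := h2' k|have := h1' _ lt; have := h2 k'];
  rewrite (ltnW lt) ?kn ?kn' => /(_ isT); rewrite leNgt => /negbTE ->.
Qed.

(* The walk reversed from the first time of its maximum stays positive, and
   the walk after that time stays below its maximum. *)
Lemma sum_neg_nonpos n : \sum_(k < n.+1) pr_neg k * pr_nonpos (n - k) = 1.
Proof.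
pose E (k : 'I_n.+1) := [set w | first_max n k w].
have mE k : measurable (E k) by apply: measurable_first_max; rewrite -ltnS.
have tE : trivIset setT E.
  apply/trivIsetP => i j _ _ /eqP ij; apply/seteqP; split=> w //= -[wi wj].
  by apply: ij; apply/val_inj/(first_max_uniq _ _ wi wj); rewrite -ltnS.
have <- : p (\big[setU/set0]_(k < n.+1) E k) = 1.
  rewrite (_ : \big[setU/set0]_(k < n.+1) E k = setT) ?pr_setT//.
  apply/seteqP; split=> w // _; have [k kn wk] := first_max_exists n w.
  by rewrite -bigcup_mkord_ord; exists k => //=; rewrite /E /= inordK.
apply: EFin_inj; rewrite -prE; last exact: bigsetU_measurable.
rewrite measure_bigsetU_ord// -sumEFin; apply: eq_bigr => k _.
have kn : (k <= n)%N by rewrite -ltnS.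
by rewrite -(pr_first_max kn); rewrite /pr fineK// fin_num_measure//; exact: mE.
Qed.

End walk_events.

(** * Two-sided order of the persistence probabilities, and the rarity of walks with few nonzero
    steps *)

Section persistence.
Context d (T : measurableType d) (R : realType) (P : probability T R).
Context (xi : nat -> {RV P >-> int}) (xi_iid : iid xi).
Hypothesis xi_sym : symmetric_rv (xi 0%N).
Local Notation p := (pr P).
Local Notation u := (pr_nonpos xi).
Local Notation v := (pr_neg xi).

Let c : R := p (xi 0%N @^-1` [set k | k < 0]).
Hypothesis c0 : 0 < c.

Let v0 n : 0 <= v n. Proof. exact: pr_ge0. Qed.
Let u0 n : 0 <= u n. Proof. exact: pr_ge0. Qed.

(** Each of the [n.+1] terms of [sum_neg_nonpos] is at least [v n ^+ 2], because [v] is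
    nonincreasing and [v <= u]. *)
Lemma pr_neg_le n : v n <= (Num.sqrt n.+1%:R)^-1.
Proof.
rewrite -(ger0_norm (v0 n)) -sqrtr_sqr -sqrtrV// ler_sqrt ?invr_ge0//.
rewrite -[leRHS]mul1r ler_pdivlMr// -[leRHS](sum_neg_nonpos xi_iid xi_sym n).
rewrite mulr_natr -[n.+1 in leLHS]card_ord -sumr_const; apply: ler_sum => k _.
rewrite expr2 ler_pM//; first by apply: pr_neg_nincr; rewrite -ltnS.
by apply: le_trans (pr_neg_le_nonpos _ _); apply: pr_neg_nincr; rewrite leq_subr.
Qed.

Lemma pr_nonpos_le n : u n <= c^-1 / Num.sqrt n.+1%:R.
Proof.
rewrite ler_pdivlMl//; apply: (le_trans (pr_nonpos_first_step xi_iid n)).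
apply: (le_trans (pr_neg_le _)).
by rewrite lef_pV2 ?posrE ?sqrtr_gt0// ler_sqrt// ler_nat.
Qed.

Lemma sum_invsqrt n : \sum_(k < n) (Num.sqrt k.+1%:R)^-1 <= 2 * Num.sqrt n%:R :> R.
Proof.
elim: n => [|n IH]; first by rewrite big_ord0 sqrtr0 mulr0.
rewrite big_ord_recr/=; apply: (le_trans (lerD IH (lexx _))).
set a := Num.sqrt n%:R; set b := Num.sqrt n.+1%:R.
have b0 : 0 < b by rewrite sqrtr_gt0.
have a0 : 0 <= a by exact: sqrtr_ge0.
have eab : b ^+ 2 = a ^+ 2 + 1 by rewrite !sqr_sqrtr// -natr1.
rewrite -(ler_pM2r b0) mulrDl mulVf ?gt_eqF//.
(* Multiplied by [b], the claim reads [2 a b + 1 <= 2 b ^ 2]; with [b ^ 2 = a ^ 2 + 1] this is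
   exactly the nonnegativity of the square. *)
have : 0 <= (a - b) ^+ 2 by exact: sqr_ge0.
by move: eab; rewrite !expr2; nra.
Qed.

Lemma sum_pr_nonpos_le n : \sum_(k < n) u k <= 2 * c^-1 * Num.sqrt n%:R.
Proof.
apply: (@le_trans _ _ (\sum_(k < n) c^-1 / Num.sqrt k.+1%:R)).
  by apply: ler_sum => k _; exact: pr_nonpos_le.
rewrite -mulr_sumr mulrAC mulrC ler_pM2r ?invr_gt0//; exact: sum_invsqrt.
Qed.

(* In the identity [sum_neg_nonpos] at time 2n one of the two factors has index
   at least n, hence 1 <= 2 u_n (u_0 + ... + u_n) = O(u_n sqrt n). *)
Lemma pr_nonpos_ge n : c / (4 * Num.sqrt n.+1%:R) <= u n.
Proof.
have h : 1 <= u n * (2 * \sum_(k < n.+1) u k).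
  rewrite -[leLHS](sum_neg_nonpos xi_iid xi_sym (n + n)).
  rewrite -(big_mkord xpredT (fun k => v k * u (n + n - k))).
  rewrite (big_cat_nat _ (n := n.+1))//=; last lia.
  rewrite mulr_natl mulr2n mulrDr; apply: lerD.
    rewrite big_mkord mulr_sumr; apply: ler_sum => k _; rewrite mulrC.
    apply: ler_pM => //; last exact: pr_neg_le_nonpos.
    by apply: pr_nonpos_nincr; have := ltn_ord k; lia.
  rewrite big_ord_recr/= mulrDr -[leLHS]addr0 lerD ?mulr_ge0//.
  rewrite mulr_sumr -[leRHS](big_mkord xpredT (fun k => u n * u k)).
  rewrite big_nat_rev/= -{1}[n.+1]add0n big_addn.
  rewrite (_ : (n + n).+1 - n.+1 = n)%N; last lia.
  apply: ler_sum_nat => k /andP[_ kn].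
  apply: ler_pM => //.
    apply: (le_trans (pr_neg_le_nonpos _ _)); apply: pr_nonpos_nincr; lia.
  by apply: pr_nonpos_nincr; lia.
have s0 : 0 < Num.sqrt n.+1%:R :> R by rewrite sqrtr_gt0.
rewrite ler_pdivrMr ?mulr_gt0//.
have := le_trans h (ler_wpM2l (u0 n) (ler_wpM2l _ (sum_pr_nonpos_le n.+1))).
rewrite -(ler_pM2r c0) mul1r => /(_ (ler0n _ 2)); congr (_ <= _).
by field; rewrite gt_eqF.
Qed.

Let mS s := measurable_steps s (measurable_fibers_xi xi).
Let mSB s B := measurable_preimage_countable (mS s) B.
Let rho : R := p (xi 0%N @^-1` [set k | k != 0]).

(* Exponential Markov inequality: 1 - rho/2 is the mean of 2^-1 on a nonzero
   step and 1 on a zero step. *)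
Lemma pr_few_steps n r :
  p [set w | (count (predC1 0%R) (steps xi (iota 0 n) w) <= r)%N]
    <= 2 ^+ r * (1 - rho / 2) ^+ n.
Proof.
pose C r := [set l | (count (predC1 (0 : int)) l <= r)%N].
have mxi B : measurable (xi 0%N @^-1` B).
  exact: (measurable_preimage_countable (measurable_fibers_xi xi 0)).
have rho1 : rho <= 1 by apply: pr_le1.
have rho0 : 0 <= rho by apply: pr_ge0.
have rhoC : p (xi 0%N @^-1` [set 0]) = 1 - rho.
  rewrite -pr_setC//; congr (p _); apply/seteqP; split=> w /=.
    by move=> ->; rewrite eqxx.
  by move/negP; rewrite negbK => /eqP.
change (p (steps xi (iota 0 n) @^-1` C r) <= 2 ^+ r * (1 - rho / 2) ^+ n).
elim: n r => [|n IH] r.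
  by rewrite expr0 mulr1 (le_trans (pr_le1 P (mSB _ _)))// exprn_ege1// ler1n.
have IH1 r' : p (steps xi (iota 1 n) @^-1` C r') <= 2 ^+ r' * (1 - rho / 2) ^+ n.
  apply: le_trans (IH r'); rewrite (@steps_law _ _ _ _ _ xi_iid _ (iota 0 n))//.
  - exact: iota_uniq.
  - exact: iota_uniq.
  - by rewrite !size_iota.
have ind A B : p (xi 0%N @^-1` A `&` steps xi (iota 1 n) @^-1` B) =
    p (xi 0%N @^-1` A) * p (steps xi (iota 1 n) @^-1` B).
  have e : xi 0%N @^-1` A = steps xi [:: 0%N] @^-1` [set l | A (nth 0 l 0)] by [].
  by rewrite e steps_indep//= mem_iota iota_uniq.
(* A nonzero first step uses up one unit of the allowance [r]; with [r = 0] no such step is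
   allowed. *)
pose D := if r is r'.+1 then C r' else set0.
apply: (@le_trans _ _ (p ((xi 0%N @^-1` [set 0] `&` steps xi (iota 1 n) @^-1` C r) `|`
    (xi 0%N @^-1` [set k | k != 0] `&` steps xi (iota 1 n) @^-1` D)))).
  apply: le_pr => //.
    by apply: measurableU; apply: measurableI => //; exact: mSB.
  move=> w; rewrite /C /D /preimage /=.
  have [->|x0] := eqVneq (xi 0%N w) 0; first by left.
  by case: r {D} => // r; rewrite add1n ltnS; right.
apply: (le_trans (pr_setU _ _ _)); rewrite ?ind.
- by apply: measurableI => //; exact: mSB.
- by apply: measurableI => //; exact: mSB.
have th0 : 0 <= 1 - rho / 2 by lra.
have hD : p (steps xi (iota 1 n) @^-1` D) <= 2 ^+ r / 2 * (1 - rho / 2) ^+ n.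
  rewrite /D; case: r {D} => [|r].
    by rewrite preimage_set0 /pr measure0 !mulr_ge0 ?exprn_ge0.
  by rewrite exprSr mulfK ?pnatr_eq0.
apply: (@le_trans _ _ ((1 - rho) * (2 ^+ r * (1 - rho / 2) ^+ n) +
   rho * (2 ^+ r / 2 * (1 - rho / 2) ^+ n))).
  rewrite rhoC; apply: lerD; first by rewrite ler_wpM2l// subr_ge0.
  by rewrite ler_wpM2l.
by rewrite exprS le_eqVlt; apply/orP; left; apply/eqP; field.
Qed.

End persistence.
(** * Tails from characteristic functions *)

Section measurable_order.
Context d (T : measurableType d) (R : realType) (f g : T -> R).
Hypotheses (mf : measurable_fun setT f) (mg : measurable_fun setT g).

Lemma measurable_set_le : measurable [set w | f w <= g w].
Proof.
by rewrite -[X in measurable X]setTI; exact: (measurable_fun_le measurableT mf mg).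
Qed.

Lemma measurable_set_lt : measurable [set w | g w < f w].
Proof.
rewrite (_ : mkset _ = ~` [set w | f w <= g w]).
  by apply: measurableC; exact: measurable_set_le.
by apply/seteqP; split=> w /=; rewrite ltNge => /negP.
Qed.

End measurable_order.

Section bounded_expectation.
Context d (T : measurableType d) (R : realType) (P : probability T R).
Implicit Types f g : T -> R.

Definition bounded_rv f :=
  measurable_fun setT f /\ exists M, forall w, `|f w| <= M.

Definition Ex f : R := (\int[P]_w f w)%R.

Lemma bounded_rv_integrable f : bounded_rv f -> P.-integrable setT (EFin \o f).
Proof.
move=> [mf [M fM]]; apply: measurable_bounded_integrable => //.
  by apply: fin_num_fun_lty; exact: fin_num_measure.
by exists M; split; [exact: num_real|move=> x Mx w _ /=; exact/(le_trans (fM w))/ltW].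
Qed.

Lemma ExE f : bounded_rv f -> (\int[P]_w (f w)%:E)%E = (Ex f)%:E.
Proof.
by move=> bf; rewrite /Ex /Rintegral fineK//; apply: integrable_fin_num => //;
  exact: bounded_rv_integrable.
Qed.

Lemma bounded_rv_cst (a : R) : bounded_rv (fun=> a).
Proof. by split; [exact: measurable_cst|exists `|a|]. Qed.

Lemma bounded_rvD f g : bounded_rv f -> bounded_rv g ->
  bounded_rv (fun w => f w + g w).
Proof.
move=> [mf [M fM]] [mg [N gN]]; split; first exact: measurable_funD.
by exists (M + N) => w; apply: (le_trans (ler_normD _ _)); exact: lerD.
Qed.

Lemma bounded_rvZ (a : R) f : bounded_rv f -> bounded_rv (fun w => a * f w).
Proof.
move=> [mf [M fM]]; split; first exact: measurable_funM.
by exists (`|a| * M) => w; rewrite normrM ler_wpM2l.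
Qed.

Lemma bounded_rv_indic (A : set T) : measurable A -> bounded_rv (\1_A : T -> R).
Proof.
move=> mA; split; first exact: measurable_indic.
by exists 1 => w; rewrite indicE; case: (_ \in _); rewrite ?normr1 ?normr0.
Qed.

Lemma bounded_rv_sum n (F : nat -> T -> R) : (forall i, bounded_rv (F i)) ->
  bounded_rv (fun w => \sum_(i < n) F i w).
Proof.
move=> bF; elim: n => [|n IH].
  rewrite (_ : (fun=> _) = (fun=> 0)); first exact: bounded_rv_cst.
  by apply/funext => w; rewrite big_ord0.
rewrite (_ : (fun=> _) = (fun w => \sum_(i < n) F i w + F n w)).
  exact: bounded_rvD.
by apply/funext => w; rewrite big_ord_recr.
Qed.

Lemma Ex_cst (a : R) : Ex (fun=> a) = a.
Proof.
rewrite /Ex Rintegral_cst// (_ : fine _ = 1) ?mulr1//.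
exact: (pr_setT P).
Qed.

Lemma ExD f g : bounded_rv f -> bounded_rv g ->
  Ex (fun w => f w + g w) = Ex f + Ex g.
Proof. by move=> bf bg; rewrite /Ex RintegralD//; exact: bounded_rv_integrable. Qed.

Lemma ExZ (a : R) f : bounded_rv f -> Ex (fun w => a * f w) = a * Ex f.
Proof. by move=> bf; rewrite /Ex RintegralZl//; exact: bounded_rv_integrable. Qed.

Lemma Ex_indic A : measurable A -> Ex (\1_A : T -> R) = pr P A.
Proof.
move=> mA; rewrite /Ex /Rintegral; congr fine.
by rewrite integral_indic// setIT.
Qed.

Lemma Ex_sum n (F : nat -> T -> R) : (forall i, bounded_rv (F i)) ->
  Ex (fun w => \sum_(i < n) F i w) = \sum_(i < n) Ex (F i).
Proof.
move=> bF; elim: n => [|n IH].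
  rewrite big_ord0 (_ : (fun=> _) = (fun=> 0)); first exact: Ex_cst.
  by apply/funext => w; rewrite big_ord0.
rewrite (_ : (fun=> _) = (fun w => \sum_(i < n) F i w + F n w)).
  by rewrite ExD ?IH ?big_ord_recr//; exact: bounded_rv_sum.
by apply/funext => w; rewrite big_ord_recr.
Qed.

Lemma le_Ex f g : bounded_rv f -> bounded_rv g -> (forall w, f w <= g w) ->
  Ex f <= Ex g.
Proof. by move=> bf bg fg; apply: le_Rintegral => //; exact: bounded_rv_integrable. Qed.

Lemma Ex_ge0 f : (forall w, 0 <= f w) -> 0 <= Ex f.
Proof. by move=> f0; apply: Rintegral_ge0. Qed.

Lemma markov_pr f (a : R) (A : set T) : bounded_rv f -> 0 < a -> measurable A ->
  (forall w, 0 <= f w) -> (forall w, A w -> a <= f w) -> pr P A <= Ex f / a.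
Proof.
move=> bf a0 mA f0 fA; rewrite ler_pdivlMr// -Ex_indic// mulrC -ExZ; last exact: bounded_rv_indic.
apply: le_Ex => // [|w]; first by apply: bounded_rvZ; exact: bounded_rv_indic.
rewrite indicE; have [/set_mem/fA|_] := boolP (w \in A); first by rewrite mulr1.
by rewrite mulr0.
Qed.

End bounded_expectation.

(** * Numerical bounds on the cosine *)

Section cos_bounds.
Context {R : realType}.

(** From [cos 2 < 0] and the duplication formula, [(cos 1)^2 < 1/2 < (3/4)^2]. *)
Lemma cos1_le : cos (1 : R) <= 3 / 4.
Proof.
have := @cos2_lt0 R; have := @cos1_gt0 R.
rewrite -[in cos 2]/(1 *+ 2) cos_mulr2n mulr2n expr2.
by move: (cos 1) => c c0 c2; nra.
Qed.

Lemma cos_le_12 (x : R) : 1 <= x <= 2 -> cos x <= 3 / 4.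
Proof.
move=> /andP[x1 x2]; apply: le_trans cos1_le; rewrite leNgt; apply/negP.
have pi2 := @pi_ge2 R; rewrite ltr_cos ?in_itv/=; first by move=> ?; lra.
  by apply/andP; split; lra.
by apply/andP; split; lra.
Qed.

(** Monotonicity reduces to [x = 1/2], where [cos 1 > 0] and the duplication formula give
    [(cos (1/2))^2 > 1/2]. *)
Lemma cos_ge_half (x : R) : `|x| <= 2^-1 -> 2^-1 <= cos x.
Proof.
move=> x2; rewrite -(cos_norm x).
have h : cos (2^-1 : R) <= cos `|x|.
  have pi2 := @pi_ge2 R; have x0 := normr_ge0 x.
  rewrite leNgt; apply/negP; rewrite ltr_cos ?in_itv/=; first by move=> ?; lra.
    by apply/andP; split; lra.
  by apply/andP; split; lra.
apply: le_trans h.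
have h0 : 0 <= cos (2^-1 : R).
  by apply: cos_ge0_pihalf; have := @pi_ge2 R => ?; apply/andP; split; lra.
have : 0 < cos (2^-1 *+ 2 : R).
  by rewrite mulr2n (_ : 2^-1 + 2^-1 = 1) ?cos1_gt0//; lra.
by rewrite cos_mulr2n mulr2n expr2; move: (cos 2^-1) h0 => c h0; nra.
Qed.

(* The factor 1/3 beats the 2^-p of a p-homogeneous bound with p < 1. *)
Lemma oneBcos_double (x : R) : `|x| <= 2^-1 -> 1 - cos x <= (1 - cos (2 * x)) / 3.
Proof.
(* [1 - cos (2 x) = 2 (1 + cos x) (1 - cos x)], and [2 (1 + cos x) >= 3]. *)
move=> /cos_ge_half; rewrite mulr_natl cos_mulr2n.
by have := cos_le1 x; nra.
Qed.

Lemma oneBcos_iter (x : R) n : 2 ^+ n * `|x| <= 1 ->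
  1 - cos x <= (1 - cos (2 ^+ n * x)) / 3 ^+ n.
Proof.
elim: n x => [|n IH] x; first by rewrite !expr0 !mul1r divr1.
rewrite exprSr -mulrA => h.
have h2 : 2 ^+ n * `|2 * x| <= 1 by rewrite normrM normr_nat.
have hx : `|x| <= 2^-1.
  have : 1 * (2 * `|x|) <= 2 ^+ n * (2 * `|x|).
    by rewrite ler_wpM2r ?mulr_ge0// exprn_ege1// ler1n.
  by move: h; lra.
apply: (le_trans (oneBcos_double hx)).
rewrite -?(mulrA (2 ^+ n)) exprSr invfM [leRHS]mulrA ler_pM2r ?invr_gt0//; exact: IH.
Qed.

End cos_bounds.

(** * Upper tail bounds from the characteristic function *)

Section tails.
Context d (T : measurableType d) (R : realType) (P : probability T R).
Context (X : T -> R) (mX : measurable_fun setT X).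
Local Notation E := (Ex P).

Definition oneBcos s w : R := 1 - cos (s * X w).
(** One minus the real part of the characteristic function, by [phiE]. *)
Definition phi s : R := E (oneBcos s).
(** The level is [1/a], so that [phi], [tail] and [tmean] are all compared with powers of a variable
    tending to 0. *)
Definition tail a : R := pr P [set w | 1 <= a * `|X w|].
Definition tmean a : R := E (fun w => Num.min 1 (a * `|X w|)).

Lemma bounded_rv_cos s : bounded_rv (fun w => cos (s * X w)).
Proof.
split; last by exists 1 => w; exact: cos_max.
apply: measurableT_comp; first by apply: continuous_measurable_fun; exact: continuous_cos.
exact: measurable_funM.
Qed.

Lemma bounded_rv_oneBcos s : bounded_rv (oneBcos s).
Proof.
rewrite (_ : oneBcos s = fun w => 1 + (-1) * cos (s * X w)).
  apply: bounded_rvD; first exact: bounded_rv_cst.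
  by apply: bounded_rvZ; exact: bounded_rv_cos.
by apply/funext => w; rewrite mulN1r.
Qed.

Lemma oneBcos_ge0 s w : 0 <= oneBcos s w.
Proof. by rewrite subr_ge0 cos_le1. Qed.

Lemma measurable_absM a : measurable_fun setT (fun w => a * `|X w|).
Proof.
apply: measurable_funM => //; exact: measurableT_comp.
Qed.

Lemma measurable_tail a : measurable [set w | 1 <= a * `|X w|].
Proof.
apply: measurable_set_le; first exact: measurable_cst.
exact: measurable_absM.
Qed.

Lemma bounded_rv_tmean a : 0 <= a -> bounded_rv (fun w => Num.min 1 (a * `|X w|)).
Proof.
move=> a0; split; first by apply: measurable_minr; [exact: measurable_cst|exact: measurable_absM].
by exists 1 => w; rewrite ger0_norm ?ge_min ?lexx// le_min ler01 mulr_ge0.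
Qed.

Lemma phiE s : fine 'E_P[fun w => cos (s * X w)] = 1 - phi s.
Proof.
rewrite /phi (_ : oneBcos s = fun w => 1 + (-1) * cos (s * X w)); last first.
  by apply/funext => w; rewrite mulN1r.
have bc := bounded_rv_cos s; have b1 : bounded_rv (fun=> 1 : R) := bounded_rv_cst T 1.
rewrite ExD//; last exact: bounded_rvZ.
rewrite ExZ// Ex_cst mulN1r opprD addrA subrr add0r opprK.
by rewrite /Ex /Rintegral unlock.
Qed.

(** The real part of a complex number is bounded by its modulus, so for small [s] the error in [phi]
    is at most [c / 2 * s ^ p]. *)
Lemma phi_equiv (g : R -> R[i]) (p c : R) : 0 < c ->
  (forall s, complex.Re (g s) = 1 - c * s `^ p) ->
  eq_mod_littleo_at0 (charfun P X) g p ->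
  exists2 dlt : R, 0 < dlt & forall s, 0 < s <= dlt ->
    c / 2 * s `^ p <= phi s <= 2 * c * s `^ p.
Proof.
move=> c0 gE fg.
have c20 : 0 < c / 2 by rewrite divr_gt0.
have /(_ _ _ c20) := (cvgr0Pnorm_lt _).1 fg.
move=> [e /= e0 he]; exists (e / 2); first by rewrite divr_gt0.
move=> s /andP[s0 se].
have /= := he s; rewrite sub0r normrN gtr0_norm// => /(_ _ s0).
have /[swap] /[apply] : s < e by lra.
have sp : 0 < s `^ p by rewrite powR_gt0.
rewrite normrM normfV (gtr0_norm sp) ltr_pdivrMr//.
have Re_le (z : R[i]) : `|complex.Re z| <= `|ComplexField.Normc.normc z|.
  case: z => a b /=; rewrite (ger0_norm (sqrtr_ge0 _)) -[`|a|]sqrtr_sqr.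
  by rewrite ler_sqrt ?addr_ge0 ?sqr_ge0// lerDl sqr_ge0.
move=> /(le_lt_trans (Re_le _)).
rewrite raddfB /= gE phiE (_ : _ - _ = c * s `^ p - phi s); last by ring.
rewrite ltr_norml => /andP[h1 h2]; apply/andP; split; first by move: h1 h2; lra.
have : 0 < c * s `^ p by rewrite mulr_gt0.
by move: h1 h2; lra.
Qed.

Lemma tail_le1 a : tail a <= 1.
Proof. by apply: pr_le1; exact: measurable_tail. Qed.

(** The two tail events differ where [1 <= a |X| < 2]; there [1 - cos (a X) >= 1/4], and Markov's
    inequality gives the factor 4. *)
Lemma tail_half a : 0 < a -> tail a <= tail (a / 2) + 4 * phi a.
Proof.
move=> a0.
pose A := [set w | 1 <= a * `|X w|] `\` [set w | 1 <= a / 2 * `|X w|].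
have mA : measurable A by apply: measurableD; exact: measurable_tail.
have : tail a <= tail (a / 2) + pr P A.
  rewrite /tail; apply: le_trans (pr_setU _ (measurable_tail (a / 2)) mA).
  apply: le_pr; [exact: measurable_tail|exact: measurableU (measurable_tail _) mA|].
  by move=> w /= h; have [|/negP] := boolP (1 <= a / 2 * `|X w|); [left|right].
move=> /le_trans; apply; rewrite lerD2l.
have h4 : (0 : R) < 4^-1 by rewrite invr_gt0.
have := @markov_pr _ _ _ P (oneBcos a) _ A (bounded_rv_oneBcos a) h4 mA (oneBcos_ge0 a).
rewrite invrK mulrC; apply => w [/= x1 /negP]; rewrite -ltNge => x2.
rewrite /oneBcos -cos_norm normrM gtr0_norm//.
have : cos (a * `|X w|) <= 3 / 4 by apply: cos_le_12; apply/andP; split; lra.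
by lra.
Qed.

Lemma tail_cvg0 a : 0 < a -> tail (a / 2 ^+ n) @[n --> \oo] --> 0.
Proof.
move=> a0; pose F n := [set w | 1 <= a / 2 ^+ n * `|X w|].
have mF n : measurable (F n) by exact: measurable_tail.
have F0 : \bigcap_n F n = set0.
  apply/seteqP; split=> w //= h.
  have := h (Num.bound (a * `|X w|)) I; rewrite /F /=.
  rewrite mulrAC ler_pdivlMr ?exprn_gt0// mul1r leNgt => /negP; apply.
  apply: (lt_trans (archi_boundP (mulr_ge0 (ltW a0) (normr_ge0 (X w))))).
  by rewrite -natrX ltr_nat ltn_expl.
have P0 : (P (F 0%N) < +oo)%E by rewrite (prE P (mF 0%N)) ltry.
have mI : measurable (\bigcap_n F n) by rewrite F0.
have dF : nonincreasing_seq F.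
  move=> m n mn; apply/subsetPset => w; rewrite /F /= => h; apply: (le_trans h).
  rewrite ler_wpM2r// ler_wpM2l ?(ltW a0)// lef_pV2 ?posrE ?exprn_gt0//.
  by rewrite ler_weXn2l// ler1n.
have := nonincreasing_cvg_mu P0 mF mI dF.
by rewrite F0 measure0 => /fine_cvgP[_].
Qed.

(** Iterating [tail_half] bounds the tail by the sum of [4 C (a / 2^n)^p], a geometric series; [K]
    is its sum at [a = 1], and the remainder vanishes by [tail_cvg0]. *)
Lemma tail_le (p C dlt : R) : 0 < p -> 0 < C -> 0 < dlt ->
  (forall s, 0 < s <= dlt -> phi s <= C * s `^ p) ->
  exists2 K, 0 < K & forall a, 0 < a -> tail a <= K * a `^ p.
Proof.
move=> p0 C0 d0 hphi.
have r1 : (2^-1 : R) `^ p < 1.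
  have := gt0_ltr_powR p0 (_ : 2^-1 \in Num.nneg) (_ : 1 \in Num.nneg).
  by rewrite !nnegrE powR1; apply=> //; lra.
pose K := 4 * C / (1 - 2^-1 `^ p).
have K0 : 0 < K by rewrite divr_gt0 ?subr_gt0// mulr_gt0.
have step a : 0 < a <= dlt -> tail a <= K * a `^ p.
  move=> /andP[a0 ad].
  have iter n : tail a <= K * a `^ p - K * (a / 2 ^+ n) `^ p + tail (a / 2 ^+ n).
    elim: n => [|n IH]; first by rewrite expr0 divr1 subrr add0r.
    apply: (le_trans IH); set b := a / 2 ^+ n.
    have -> : a / 2 ^+ n.+1 = b / 2 by rewrite exprSr invfM mulrA.
    have b0 : 0 < b by rewrite divr_gt0 ?exprn_gt0.
    have bd : b <= dlt.
      apply: le_trans ad; rewrite ler_pdivrMr ?exprn_gt0//.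
      by rewrite ler_peMr ?(ltW a0)// exprn_ege1// ler1n.
    have := tail_half b0; have := hphi b; rewrite b0 bd => /(_ isT).
    rewrite (powRM _ (ltW b0)); last by [].
    have : 4 * C = K * (1 - 2^-1 `^ p) by rewrite /K divfK// subr_eq0 gt_eqF.
    move: (b `^ p) (phi b) (tail b) (tail (b / 2)) (2^-1 `^ p) (a `^ p) => B f q q' h A.
    move=> e h1 h2.
    have e2 : 4 * (C * B) = K * (1 - h) * B by rewrite mulrA e.
    by move: e2 h1 h2; lra.
  have lim : tail (a / 2 ^+ n) + K * a `^ p @[n --> \oo] --> 0 + K * a `^ p.
    by apply: cvgD; [exact: tail_cvg0|exact: cvg_cst].
  rewrite -[leRHS]add0r; apply: (cvgr_to_ge lim); near=> n.
  apply: (le_trans (iter n)); rewrite [leLHS]addrC lerD2l gerBl.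
  by rewrite mulr_ge0 ?powR_ge0// ltW.
(* The added term covers [a > dlt], where the trivial bound 1 is at most [(a / dlt)^p]. *)
pose K' := K + (dlt `^ p)^-1.
have dp0 : 0 < dlt `^ p by rewrite powR_gt0.
exists K'; first by rewrite addr_gt0// invr_gt0.
move=> a a0; have ap0 : 0 <= a `^ p by rewrite powR_ge0.
have [ad|da] := leP a dlt.
  apply: (le_trans (step a _)); first by rewrite a0.
  by rewrite ler_wpM2r// lerDl invr_ge0 ltW.
apply: (le_trans (tail_le1 a)); rewrite mulrDl -[leLHS]add0r lerD//.
  by rewrite mulr_ge0// ltW.
by rewrite mulrC ler_pdivlMr// mul1r ge0_ler_powR ?nnegrE ?ltW.
Unshelve. all: by end_near.
Qed.

End tails.
Lemma ltr_powR2 (R : realType) (x y : R) : x < y -> 2 `^ x < 2 `^ y.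
Proof. by move=> xy; rewrite /powR pnatr_eq0 ltr_expR ltr_pM2r// ln_gt0// ltr1n. Qed.

(** * Truncated means from tails, and the lower tail bound *)

Section truncated_mean.
Context d (T : measurableType d) (R : realType) (P : probability T R).
Context (X : T -> R) (mX : measurable_fun setT X).
Local Notation E := (Ex P).
Local Notation tmean := (tmean P X).
Local Notation tail := (tail P X).
Local Notation phi := (phi P X).

Lemma tmean_le1 a : 0 <= a -> tmean a <= 1.
Proof.
move=> a0; rewrite -(Ex_cst P 1); apply: le_Ex.
- exact: bounded_rv_tmean.
- exact: bounded_rv_cst.
- by move=> w; rewrite ge_min lexx.
Qed.

Lemma tmean_ndecr a b : 0 <= a -> a <= b -> tmean a <= tmean b.
Proof.
move=> a0 ab; apply: le_Ex; do ?exact: bounded_rv_tmean.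
  by apply: bounded_rv_tmean => //; exact: le_trans ab.
by move=> w; rewrite le_min !ge_min lexx ler_wpM2r ?orbT.
Qed.

(** Pointwise: if [2 a |X| < 1] both sides equal [a |X|], and otherwise the right side is 1. *)
Lemma tmean_double a : 0 < a -> tmean a <= tmean (2 * a) / 2 + tail (2 * a) / 2.
Proof.
move=> a0; have a2 : 0 <= 2 * a by rewrite mulr_ge0// ltW.
have mt := measurable_tail mX (2 * a).
have b1 := bounded_rv_tmean mX a2; have b2 := bounded_rv_indic R mt.
rewrite ![_ / 2]mulrC /tail -Ex_indic// -!ExZ// -ExD; do ?exact: bounded_rvZ.
apply: le_Ex; [exact: bounded_rv_tmean (ltW a0)| |].
  by apply: bounded_rvD; exact: bounded_rvZ.
move=> w; rewrite indicE -mulrA.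
have y0 : 0 <= a * `|X w| by rewrite mulr_ge0// ltW.
have [/set_mem/= y1|/negP y1] := boolP (w \in [set w | 1 <= 2 * a * `|X w|]).
  move: y1; rewrite -mulrA; move: (a * `|X w|) y0 => y y0 y1.
  by rewrite [Num.min 1 (2 * y)]min_l// mulr1 ge_min; apply/orP; left; lra.
have {y1} : 2 * a * `|X w| < 1.
  by rewrite ltNge; apply/negP => h; apply: y1; rewrite inE.
rewrite -mulrA; move: (a * `|X w|) y0 => y y0 y1.
by rewrite [Num.min 1 (2 * y)]min_r ?(ltW y1)// mulr0 ge_min; apply/orP; right; lra.
Qed.

Lemma dyadic_ind (Q : R -> Prop) :
  (forall a, 2^-1 < a <= 1 -> Q a) ->
  (forall a, 0 < a <= 2^-1 -> Q (2 * a) -> Q a) ->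
  forall a, 0 < a <= 1 -> Q a.
Proof.
move=> Q1 Q2; have H n a : 0 < a <= 1 -> 1 <= a * 2 ^+ n -> Q a.
  elim: n a => [|n IH] a /andP[a0 a1].
    by rewrite expr0 mulr1 => ?; apply: Q1; apply/andP; split; lra.
  have [a2|a2] := leP a 2^-1; last by move=> _; apply: Q1; rewrite a2.
  rewrite exprS mulrA => h; apply: Q2; first by rewrite a0.
  by apply: IH; [apply/andP; split; lra|rewrite [2 * a]mulrC].
move=> a /andP[a0 a1]; have ai0 : 0 <= a^-1 by rewrite invr_ge0 ltW.
apply: (H (Num.bound a^-1)); first by rewrite a0.
rewrite mulrC -ler_pdivrMr// mul1r; apply/ltW/(lt_trans (archi_boundP ai0)).
by rewrite -natrX ltr_nat ltn_expl.
Qed.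

Section from_tail.
Context (p K : R).
Hypotheses (p0 : 0 < p) (K0 : 0 < K).
Hypothesis tailK : forall a, 0 < a -> tail a <= K * a `^ p.

Let step a : 0 < a -> tmean a <= tmean (2 * a) / 2 + K * 2 `^ p / 2 * a `^ p.
Proof.
move=> a0; apply: (le_trans (tmean_double a0)); rewrite lerD2l.
have a20 : 0 < 2 * a by rewrite mulr_gt0.
by have := tailK a20; rewrite powRM ?(ltW a0)//; lra.
Qed.

Let powR2M a : 0 < a -> (2 * a) `^ p = 2 `^ p * a `^ p.
Proof. by move=> a0; rewrite powRM// ltW. Qed.

Let pow2_gt0 : 0 < 2 `^ p. Proof. exact: powR_gt0. Qed.

Lemma tmean_le_lt1 : p < 1 ->
  exists2 C, 0 < C & forall a, 0 < a -> tmean a <= C * a `^ p.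
Proof.
move=> p1; have p2 : 2 `^ p < 2.
  by rewrite -[ltRHS](@powRr1 R 2)// ltr_powR2.
have q0 := pow2_gt0; have stepq := step; have powq := powR2M.
set q := 2 `^ p in p2 q0 stepq powq.
have q2 : 0 < 2 - q by rewrite subr_gt0.
(* The doubling step needs [C (2 - q) >= K q]; the summand [q] gives [C a^p >= (2 a)^p >= 1] on
   [(1/2, 1]]. *)
pose C := q + K * q / (2 - q).
have C0 : 0 < C by rewrite addr_gt0// divr_gt0// mulr_gt0.
exists C => // a a0.
have [a1|a1] := leP a 1; last first.
  apply: (le_trans (tmean_le1 (ltW a0))).
  have q1 : 1 <= q by rewrite -(powRr0 2) /q ler_powR ?ler1n// ltW.
  have a1p : 1 <= a `^ p by rewrite -(powRr0 a); apply: ler_powR; exact: ltW.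
  have : 0 < K * q / (2 - q) by rewrite divr_gt0// mulr_gt0.
  by rewrite -[leLHS]mulr1 => h; apply: ler_pM => //; rewrite /C; lra.
have a01 : 0 < a <= 1 by rewrite a0.
move: {a0 a1} a a01; apply: dyadic_ind => [a /andP[a2 a1]|a /andP[a0 a2] IH].
  have a0 : 0 < a by lra.
  apply: (le_trans (tmean_le1 (ltW a0))).
  have : 1 <= (2 * a) `^ p.
    by rewrite -[leLHS](powRr0 (2 * a)); apply: ler_powR; [lra|exact: ltW].
  rewrite powq// => /le_trans; apply; rewrite ler_wpM2r ?powR_ge0// lerDl.
  by rewrite divr_ge0 ?mulr_ge0 ?ltW.
apply: (le_trans (stepq _ a0)); move: IH; rewrite powq//.
have e : C * (2 - q) = q * (2 - q) + K * q by rewrite /C mulrDl divfK ?gt_eqF.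
have := powR_ge0 a p; move: (a `^ p) (tmean _) => A m A0 IH.
have : 0 <= (q * (2 - q)) * A by rewrite !mulr_ge0// ltW.
have : C * (2 - q) * A = (q * (2 - q) + K * q) * A by rewrite e.
by move: IH; lra.
Qed.

Lemma tmean_le_gt1 : 1 < p ->
  exists2 C, 0 < C & forall a, 0 < a -> tmean a <= C * a.
Proof.
move=> p1; have p2 : 2 < 2 `^ p.
  by rewrite -[ltLHS](@powRr1 R 2)// ltr_powR2.
have q0 := pow2_gt0; have stepq := step; have powq := powR2M.
set q := 2 `^ p in p2 q0 stepq powq.
have q2 : 0 < q - 2 by rewrite subr_gt0.
pose D := K * q / (q - 2).
have D0 : 0 < D by rewrite divr_gt0// mulr_gt0.
pose C := 2 + 2 * D.
have C0 : 0 < C by rewrite addr_gt0// mulr_gt0.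
exists C => // a a0.
have [a1|a1] := leP a 1; last first.
  apply: (le_trans (tmean_le1 (ltW a0))).
  by rewrite -[leLHS]mulr1 /C; apply: ler_pM => //; [move: D0; lra|exact: ltW].
(* The bound [C a] alone does not survive the doubling step, which adds a multiple of [a^p]. The
   subtracted term absorbs it exactly when [D (q - 2) = K q], and [C = 2 + 2 D] secures the start on
   [(1/2, 1]]. *)
apply: (@le_trans _ _ (C * a - D * a `^ p)); last first.
  by rewrite gerBl mulr_ge0 ?powR_ge0// ltW.
have a01 : 0 < a <= 1 by rewrite a0.
move: {a0 a1} a a01; apply: dyadic_ind => [a /andP[a2 a1]|a /andP[a0 a2] IH].
  have a0 : 0 < a by lra.
  apply: (le_trans (tmean_le1 (ltW a0))).
  have ap1 : a `^ p <= 1.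
    by have := ge0_ler_powR (ltW p0) (_ : a \in Num.nneg) (_ : 1 \in Num.nneg) a1;
      rewrite !nnegrE powR1; apply=> //; exact: ltW.
  have : D * a `^ p <= D * 1 by rewrite ler_pM2l.
  have : D * 2^-1 < D * a by rewrite ltr_pM2l.
  by rewrite /C; lra.
apply: (le_trans (stepq _ a0)); move: IH; rewrite powq//.
have e : D * (q - 2) = K * q by rewrite /D divfK ?gt_eqF.
have := powR_ge0 a p; move: (a `^ p) (tmean _) => A m A0 IH.
have : D * (q - 2) * A = K * q * A by rewrite e.
by move: IH; lra.
Qed.

(** Each halving of [a] adds [K a], and about [log2 (1/a)] halvings separate [a] from 1; hence
    [D = K / ln 2]. *)
Lemma tmean_le_eq1 : p = 1 -> exists2 D, 0 < D &
  forall a, 0 < a <= 1 -> tmean a <= a * (2 - D * ln a).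
Proof.
move=> p1; have ln20 : 0 < ln (2 : R) by rewrite ln_gt0// ltr1n.
pose D := K / ln 2; have D0 : 0 < D by rewrite divr_gt0.
exists D => //; apply: dyadic_ind => [a /andP[a2 a1]|a /andP[a0 a2] IH].
  have a0 : 0 < a by lra.
  apply: (le_trans (tmean_le1 (ltW a0))).
  have : 0 <= a * D * (- ln a).
    by apply: mulr_ge0; [exact/ltW/mulr_gt0|rewrite oppr_ge0; exact: ln_le0].
  by lra.
apply: (le_trans (step a0)); move: IH.
rewrite lnM ?posrE// p1 !powRr1 ?(ltW a0)//.
have e : D * ln 2 = K by rewrite /D divfK ?gt_eqF.
have : D * ln 2 * a = K * a by rewrite e.
by move: (ln a) (tmean _) => l m; lra.
Qed.

End from_tail.

(* The frequencies 2^-J/t and 1/t are compared: below 1 the function 1 - cos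
   shrinks by 3^-J when its argument is divided by 2^J, faster than s^p. *)
Lemma tail_ge (p c C dlt : R) : 0 < p < 1 -> 0 < c -> 0 < C -> 0 < dlt ->
  (forall s, 0 < s <= dlt -> c * s `^ p <= phi s <= C * s `^ p) ->
  exists2 K, 0 < K & forall t, dlt^-1 <= t ->
    K * t `^ (- p) <= pr P [set w | t < `|X w|].
Proof.
move=> /andP[p0 p1] c0 C0 d0 h.
have [J hJ] : exists J, C * (2 / 3) ^+ J <= c / 2.
  have e0 : 0 < c / 2 / C by rewrite !divr_gt0.
  have r1 : `|2 / 3 : R| < 1 by rewrite ger0_norm//; lra.
  have /cvgr0Pnorm_lt/(_ _ e0) [N _ hN] := cvg_expr r1.
  exists N; have := hN N (leqnn N); rewrite /= ger0_norm ?exprn_ge0//.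
  by rewrite ltr_pdivlMr// mulrC => /ltW.
pose B : R := 2 ^+ J; have B1 : 1 <= B by rewrite exprn_ege1// ler1n.
have B0 : 0 < B by lra.
exists (c / 4 * B `^ (- p)); first by rewrite mulr_gt0 ?powR_gt0// divr_gt0.
move=> t dt; have t0 : 0 < t by apply: lt_le_trans dt; rewrite invr_gt0.
pose th := (B * t)^-1; have th0 : 0 < th by rewrite invr_gt0 mulr_gt0.
have Bth : B * th = t^-1 by rewrite /th invfM mulrA divff ?mul1r// gt_eqF.
have td : t^-1 <= dlt by rewrite -[leRHS]invrK lef_pV2 ?posrE ?invr_gt0.
have thd : th <= dlt by apply: le_trans td; rewrite -Bth ler_peMl// ltW.
pose A := [set w | t < `|X w|].
have mA : measurable A.
  apply: measurable_set_lt; last exact: measurable_cst.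
  exact: measurableT_comp.
have bA := bounded_rv_indic R mA.
(* On [A] the integrand is at most 2; off [A] one has [2^J th |X| <= 1], the range in which
   [oneBcos_iter] applies. *)
have : phi th <= 2 * pr P A + 3 ^- J * phi t^-1.
  rewrite -Ex_indic// /phi -!ExZ//; last exact: bounded_rv_oneBcos.
  rewrite -ExD; [|exact: bounded_rvZ|by apply: bounded_rvZ; exact: bounded_rv_oneBcos].
  apply: le_Ex; first exact: bounded_rv_oneBcos.
    by apply: bounded_rvD; apply: bounded_rvZ => //; exact: bounded_rv_oneBcos.
  move=> w; rewrite indicE.
  have [_|/negP wA] := boolP (w \in A).
    rewrite mulr1 -[leLHS]addr0 lerD//; last first.
      by rewrite mulr_ge0 ?invr_ge0 ?exprn_ge0// oneBcos_ge0.
    by rewrite /oneBcos; have := cos_geN1 (th * X w); lra.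
  have Xt : `|X w| <= t by rewrite leNgt; apply/negP => ?; apply: wA; rewrite inE.
  rewrite mulr0 add0r mulrC /oneBcos -Bth -[B * th * X w]mulrA.
  apply: oneBcos_iter; rewrite normrM gtr0_norm// mulrA Bth.
  by rewrite mulrC ler_pdivrMr// mul1r.
have /andP[h1 _] : c * th `^ p <= phi th <= C * th `^ p by apply: h; rewrite th0.
have /andP[_ h2] : c * t^-1 `^ p <= phi t^-1 <= C * t^-1 `^ p.
  by apply: h; rewrite td invr_gt0 t0.
(* Since [p < 1], [B ^ p <= B = 2^J]: the ratio of the two powers is beaten by [3^-J], and [J] was
   chosen to make the product at most half of the lower bound for [phi th]. *)
have h3 : t^-1 `^ p <= B * th `^ p.
  rewrite -Bth powRM ?(ltW th0) ?(ltW B0)// ler_wpM2r ?powR_ge0//.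
  by apply: ler1_powR => //; exact: ltW.
have e : th `^ p = B `^ (- p) * t `^ (- p).
  by rewrite /th invfM powRM ?invr_ge0 ?(ltW B0) ?(ltW t0)// -!powR_inv1 ?ltW//
    -!powRrM !mulN1r.
have h4 : 3 ^- J * phi t^-1 <= c / 2 * th `^ p.
  have i3 : 0 <= 3 ^- J :> R by rewrite invr_ge0 exprn_ge0.
  apply: (le_trans (ler_wpM2l i3 (le_trans h2 (ler_wpM2l (ltW C0) h3)))).
  rewrite [leLHS](_ : _ = C * (2 / 3) ^+ J * th `^ p).
    by rewrite ler_wpM2r// powR_ge0.
  by rewrite expr_div_n /B; ring.
by move=> h5; rewrite -(mulrA (c / 4)) -e; move: h1 h4 h5; lra.
Qed.

End truncated_mean.
(** * Measurability and independence *)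

Section path_measurability.
Context d (T : measurableType d) (R : realType).

Lemma measurable_fun_fibers (K : countType) (F : T -> K) d' (T' : measurableType d')
    (g : K -> T -> T') : measurable_fibers F ->
  (forall k, measurable_fun setT (g k)) ->
  measurable_fun setT (fun w => g (F w) w).
Proof.
move=> mF mg _ B mB; rewrite setTI -(piece_bigcup F (_ @^-1` B)).
apply: bigcupT_measurable => n.
have [[k <-]|h] := pselect (exists k : K, pickle k = n); last by rewrite piece0.
rewrite piece_pickle (_ : _ `&` _ = g k @^-1` B `&` F @^-1` [set k]).
  apply: measurableI; last exact: mF.
  by rewrite -[X in measurable X]setTI; exact: mg.
by apply/seteqP; split=> w /= [+ e]; rewrite /preimage /= e.
Qed.

Context (X : nat -> T -> int) (z : int -> T -> R).
Hypothesis mX : forall n, measurable_fibers (X n).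
Hypothesis mz : forall k, measurable_fun setT (z k).
Local Notation x := (fun w k => X k w).
Local Notation zz := (fun w k => z k w).

Lemma measurable_fibers_walk n : measurable_fibers (fun w => walk (x w) n).
Proof.
move=> k; have mS := measurable_steps (iota 0 n) mX.
rewrite (_ : _ @^-1` _ = steps X (iota 0 n) @^-1` [set l | walk (nth 0 l) n = k]).
  exact: (measurable_preimage_countable mS).
have e w : walk (nth 0 (steps X (iota 0 n) w)) n = walk (x w) n.
  by apply: (walk_eq (leqnn n)) => i i_n; rewrite nth_steps.
by apply/seteqP; split=> w /=; rewrite e.
Qed.

Lemma measurable_medium k : measurable_fun setT (fun w => medium (zz w) k).
Proof.
by case: k => n /=; [|apply: measurable_funN]; apply: measurable_sum => i; exact: mz.
Qed.

Lemma measurable_wrm n : measurable_fun setT (fun w => wrm (x w) (zz w) n).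
Proof.
exact: (measurable_fun_fibers (measurable_fibers_walk n) measurable_medium).
Qed.

Lemma measurable_jump n :
  measurable_fun setT (fun w => `|wrm (x w) (zz w) n.+1 - wrm (x w) (zz w) n|).
Proof.
by apply: measurableT_comp => //; apply: measurable_funB; exact: measurable_wrm.
Qed.

Lemma measurable_collision_time n :
  measurable_fun setT (fun w => collision_time (x w) (zz w) n).
Proof. by apply: measurable_sum => i; exact: measurable_jump. Qed.

Lemma measurable_levy_lorentz_gt0 s :
  measurable [set w | 0 < levy_lorentz (x w) (zz w) s].
Proof.
have mT := measurable_collision_time.
pose f n w := wrm (x w) (zz w) n +
  (Num.sg (X n w))%:~R * (s - collision_time (x w) (zz w) n).
rewrite (_ : mkset _ = \bigcup_n
    ([set w | collision_time (x w) (zz w) n <= s] `&`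
     [set w | s < collision_time (x w) (zz w) n.+1] `&`
     [set w | 0 < f n w])).
  apply: bigcupT_measurable => n; apply: measurableI; first apply: measurableI.
  - by apply: measurable_set_le; [exact: mT|exact: measurable_cst].
  - by apply: measurable_set_lt; [exact: mT|exact: measurable_cst].
  - apply: measurable_set_lt; last exact: measurable_cst.
    apply: measurable_funD; first exact: measurable_wrm.
    apply: measurable_funM; last by apply: measurable_funB => //; exact: mT.
    pose g (k : int) (_ : T) : R := (Num.sg k)%:~R.
    have mg k : measurable_fun setT (g k) by exact: measurable_cst.
    exact: (measurable_fun_fibers (mX n) mg).
apply/seteqP; split=> w /=.
  by move=> /levy_lorentz_gt0P[n [/andP[h1 h2] h3]]; exists n.
by move=> [n _ [[h1 h2] h3]]; apply/levy_lorentz_gt0P; exists n; split => //; apply/andP.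
Qed.

(** Rational times suffice because positivity persists for a while to the right; the margin
    [1/(m+1)] is there because the infimum need not be attained. This makes the passage event
    measurable. *)
Lemma first_passage_time_leP (y : nat -> int) (v : int -> R) t :
  (first_passage_time y v <= t%:E)%E <-> forall m : nat, exists q : rat,
    [/\ 0 < ratr q :> R, ratr q < t + m.+1%:R^-1 & 0 < levy_lorentz y v (ratr q)].
Proof.
split=> [h m|h].
  have : (first_passage_time y v < (t + m.+1%:R^-1)%:E)%E.
    by apply: (le_lt_trans h); rewrite lte_fin ltrDl invr_gt0.
  move=> /ereal_inf_lt[_ [s [s0 Xs] <-]]; rewrite lte_fin => st.
  have /levy_lorentz_gt0P[n [/andP[sn sn1] vs]] := Xs.
  set val := (X in 0 < X) in vs.
  (* Until [b] the same jump is in progress, the time window is not left, and at speed at most 1 the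
     value [val] has not dropped to 0. *)
  set b := Num.min (Num.min (collision_time y v n.+1) (t + m.+1%:R^-1)) (s + val).
  have sb : s < b by rewrite !lt_min sn1 st ltrDl.
  have [q] := rat_in_itvoo sb; rewrite in_itv/= !lt_min => /andP[sq /andP[/andP[q1 q2] q3]].
  exists q; split => //; first exact: lt_trans sq.
  apply/levy_lorentz_gt0P; exists n; split.
    by rewrite q1 andbT (le_trans sn)// ltW.
  have sg1 : `|(Num.sg (y n))%:~R : R| <= 1.
    by case: sgrP => _; rewrite ?mulrN1z ?mulr1z ?mulr0z ?normrN ?normr1 ?normr0.
  rewrite (_ : _ + _ = val + (Num.sg (y n))%:~R * (ratr q - s)); last first.
    by rewrite /val; ring.
  have : - (ratr q - s) <= (Num.sg (y n))%:~R * (ratr q - s).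
    rewrite lerNl -mulNr ler_piMl ?subr_ge0 ?(ltW sq)//.
    by move: sg1; rewrite ler_norml => /andP[]; lra.
  by move: q3; lra.
apply/lee_addgt0Pr => e e0.
have ei0 : 0 <= e^-1 by rewrite invr_ge0 ltW.
have [q [q0 qt Xq]] := h (Num.bound e^-1).
apply: (@le_trans _ _ (ratr q)%:E); first by apply: ereal_inf_lbound; exists (ratr q).
rewrite -EFinD lee_fin; apply/ltW/(lt_le_trans qt); rewrite lerD2l.
rewrite -[leRHS]invrK lef_pV2 ?posrE ?invr_gt0// ltW//.
by apply: (lt_le_trans (archi_boundP ei0)); rewrite ler_nat.
Qed.

Lemma measurable_first_passage_time t :
  measurable [set w | (t%:E < first_passage_time (x w) (zz w))%E].
Proof.
pose good m (q : rat) := (0 < ratr q :> R) && (ratr q < t + m.+1%:R^-1).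
rewrite (_ : mkset _ = ~` \bigcap_m \bigcup_(q : rat)
    (if good m q then [set w | 0 < levy_lorentz (x w) (zz w) (ratr q)] else set0)).
  apply/measurableC/bigcapT_measurable => m; apply: bigcupT_measurable_rat => q.
  by case: ifP => // _; exact: measurable_levy_lorentz_gt0.
have e w : (\bigcap_m \bigcup_(q : rat)
    (if good m q then [set w | 0 < levy_lorentz (x w) (zz w) (ratr q)] else set0)) w
    <-> (first_passage_time (x w) (zz w) <= t%:E)%E.
  split=> [h|/first_passage_time_leP h m _].
    apply/first_passage_time_leP => m; have [q _] := h m I.
    by case: ifP => // /andP[q1 q2] q3; exists q.
  have [q [q1 q2 q3]] := h m; exists q => //.
  by rewrite /good q1 q2.
apply/seteqP; split=> w /=; first by rewrite ltNge => /negP h /e.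
by move=> h; rewrite ltNge; apply/negP => /e.
Qed.

End path_measurability.

(** * Independence of walk and medium, and almost sure positivity of the bonds *)

Section independence.
Context d (T : measurableType d) (R : realType) (P : probability T R).

Lemma Ex_ident d' (T' : measurableType d') (Y Z : {RV P >-> T'}) (f : T' -> R) :
  measurable_fun setT f -> (forall y, 0 <= f y) ->
  (forall B, measurable B -> distribution P Y B = distribution P Z B) ->
  Ex P (fun w => f (Y w)) = Ex P (fun w => f (Z w)).
Proof.
move=> mf f0 YZ; rewrite /Ex /Rintegral; congr fine.
have mF : measurable_fun setT (EFin \o f) by exact/measurable_EFinP.
have F0 y : (0 <= (EFin \o f) y)%E by rewrite lee_fin.
rewrite -[LHS](ge0_integral_distribution Y mF F0).
rewrite -[RHS](ge0_integral_distribution Z mF F0).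
by apply: eq_measure_integral => B mB _; exact: YZ.
Qed.

Lemma Ex_indep_fibers (K : countType) (Y : T -> K) (A : set T) (g : K -> R) (M : R) :
  measurable_fibers Y -> measurable A -> (forall k, 0 <= g k <= M) ->
  (forall k, pr P (A `&` Y @^-1` [set k]) = pr P A * pr P (Y @^-1` [set k])) ->
  Ex P (fun w => \1_A w * g (Y w)) = pr P A * Ex P (fun w => g (Y w)).
Proof.
move=> mY mA gM ind.
have g0 k : 0 <= g k by case/andP: (gM k).
have mgY : measurable_fun setT (fun w => g (Y w)).
  by apply: (measurable_fun_fibers (g := fun k _ => g k) mY) => k; exact: measurable_cst.
have bgY : bounded_rv (fun w => g (Y w)).
  by split=> //; exists M => w; rewrite ger0_norm//; case/andP: (gM (Y w)).
have bA := bounded_rv_indic R mA.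
have b1 : bounded_rv (fun w => \1_A w * g (Y w)).
  split; first exact: measurable_funM bA.1 mgY.
  exists M => w; rewrite indicE; case: (w \in A); rewrite ?mul1r ?mul0r ?normr0.
    by rewrite ger0_norm//; case/andP: (gM (Y w)).
  by case/andP: (gM (Y w)) => h1 h2; exact: le_trans h2.
apply: EFin_inj; rewrite EFinM -!ExE//.
have mp n : measurable (piece Y setT n) by exact: measurable_piece.
have split_ (f : T -> R) : measurable_fun setT f -> (forall w, 0 <= f w) ->
    (\int[P]_w (f w)%:E = \sum_(n <oo) \int[P]_(w in piece Y setT n) (f w)%:E)%E.
  move=> mf f0; rewrite -[X in (\int[P]_(_ in X) _)%E](piece_bigcup Y setT).
  rewrite ge0_integral_bigcup//; last exact: piece_trivIset.
    by rewrite piece_bigcup; exact/measurable_EFinP.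
  by move=> w _; rewrite lee_fin.
rewrite (split_ _ b1.1); last by move=> w; rewrite mulr_ge0.
rewrite (split_ _ mgY)// -nneseriesZl//; last first.
  by move=> n _; apply: integral_ge0 => w _; rewrite lee_fin.
apply: eq_eseriesr => n _.
have [[k <-]|hn] := pselect (exists k : K, pickle k = n); last first.
  by rewrite piece0// !integral_set0 mule0.
rewrite piece_pickle setTI; set D := Y @^-1` [set k].
have mD : measurable D by exact: mY.
rewrite [RHS](_ : _ = ((pr P A)%:E * ((g k)%:E * P D))%E); last first.
  congr (_ * _)%E; rewrite -integral_cst//; apply: eq_integral => w /set_mem wD.
  by have -> : Y w = k := wD.
rewrite (eq_integral (fun w => (g k)%:E * (\1_A w)%:E)%E); last first.
  by move=> w /set_mem wD; have -> : Y w = k := wD; rewrite -EFinM mulrC.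
rewrite ge0_integralZl//; last first.
- by rewrite lee_fin.
- by apply/measurable_EFinP; exact: measurable_indic.
rewrite integral_indic//.
have hAD : (P (A `&` D) = (pr P A)%:E * P D)%E.
  by rewrite (prE P (measurableI _ _ mA mD)) ind (prE P mD).
transitivity ((g k)%:E * ((pr P A)%:E * P D))%E; last exact: muleCA.
by congr (_ * _)%E; exact: hAD.
Qed.

Context (xi : nat -> {RV P >-> int}) (zeta : int -> {RV P >-> R}).

(** The measurability of [steps] is reused with the generated sigma-algebra in place of the ambient
    one. *)
Lemma generated_steps s B : generated_sigma_algebra xi (steps xi s @^-1` B).
Proof.
pose G := [set A | exists i (B : set int), measurable B /\ A = xi i @^-1` B].
have mX n : measurable_fibers (T := g_sigma_algebraType G) (xi n).
  by move=> k; apply: sub_sigma_algebra; exists n, [set k].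
exact: (measurable_preimage_countable (measurable_steps s mX)).
Qed.

Let Gz := [set A | exists i (B : set R), measurable B /\ A = zeta i @^-1` B].

Let mz k : measurable_fun (T := g_sigma_algebraType Gz) setT (zeta k).
Proof.
by move=> _ B mB; rewrite setTI; apply: sub_sigma_algebra; exists k, B.
Qed.

Let mcst (y : nat -> int) n :
  measurable_fibers (T := g_sigma_algebraType Gz) (fun=> y n).
Proof.
move=> k; have [->|e] := pselect (y n = k).
  by rewrite (_ : _ @^-1` _ = setT); [exact: measurableT|exact/seteqP].
by rewrite (_ : _ @^-1` _ = set0); [exact: measurable0|apply/seteqP; split].
Qed.

(** Once the path is frozen to a deterministic [y], only the medium is random; this is what permits
    factoring out an event of the walk. *)
Lemma generated_collision_time (y : nat -> int) n t : generated_sigma_algebra zeta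
  [set w | t < collision_time y (fun k => zeta k w) n].
Proof.
exact: (measurable_set_lt (measurable_collision_time (mcst y) mz n) (measurable_cst t)).
Qed.

Lemma generated_sum_jumps (y : nat -> int) (Q : pred nat) n t :
  generated_sigma_algebra zeta [set w | t < \sum_(k < n | Q k)
    `|wrm y (fun k => zeta k w) k.+1 - wrm y (fun k => zeta k w) k|].
Proof.
pose J k w := `|wrm y (fun k => zeta k w) k.+1 - wrm y (fun k => zeta k w) k|.
have mS : measurable_fun (T := g_sigma_algebraType Gz) setT
    (fun w => \sum_(k < n) if Q k then J k w else 0).
  apply: measurable_sum => k; case: (Q k); last exact: measurable_cst.
  exact: (measurable_jump (mcst y) mz k).
have e : (fun w => \sum_(k < n) if Q k then J k w else 0) =
    (fun w => \sum_(k < n | Q k) J k w).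
  by apply/funext => w; rewrite [RHS]big_mkcond.
rewrite e in mS; exact: (measurable_set_lt mS (measurable_cst t)).
Qed.

Lemma generated_measurable A : generated_sigma_algebra zeta A -> measurable A.
Proof.
apply: smallest_sub; first exact: sigma_algebra_measurable.
by move=> _ [i [B [mB ->]]]; exact: measurable_funPTI.
Qed.

Hypothesis zeta_pos : forall k : int, {ae P, forall w, 0 < zeta k w}.

Definition all_pos : set T := [set w | forall k, 0 < zeta k w].

Lemma measurable_all_pos : measurable all_pos.
Proof.
rewrite (_ : all_pos = \bigcap_(k : int) [set w | 0 < zeta k w]).
  rewrite -[X in measurable X]setCK setC_bigcap; apply: measurableC.
  apply: countable_bigcupT_measurable => // k; apply: measurableC.
  by apply: measurable_set_lt; [exact: measurable_funP|exact: measurable_cst].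
by apply/seteqP; split=> w /= h k => [_|]; exact: h.
Qed.

Lemma pr_all_posC : pr P (~` all_pos) = 0.
Proof.
have : P.-negligible (~` all_pos).
  pose Q n w := forall k : int, pickle k = n -> 0 < zeta k w.
  have hQ n : \forall w \ae P, Q n w.
    have [[k <-]|hn] := pselect (exists k : int, pickle k = n).
      by apply: filterS (zeta_pos k) => w wk k' /(pcan_inj (@pickleK _)) ->.
    by apply: aeW => w k kn; exfalso; apply: hn; exists k.
  by apply: negligibleS (ae_foralln hQ) => w /= h h'; apply: h => k; exact: h'.
by move/negligibleP; rewrite /pr => ->//; apply: measurableC; exact: measurable_all_pos.
Qed.

Lemma le_pr_all_pos A B : measurable A -> measurable B ->
  A `&` all_pos `<=` B -> pr P A <= pr P B.
Proof.
move=> mA mB AB; have mO := measurable_all_pos.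
rewrite -[leRHS]addr0 -pr_all_posC.
apply: le_trans (pr_setU _ mB (measurableC mO)).
apply: le_pr => //; first by apply: measurableU => //; exact: measurableC.
move=> w Aw; have [Ow|Ow] := pselect (all_pos w); [left; exact: AB|by right].
Qed.

End independence.
(** * Bounds at a fixed time *)

Section upper_bound.
Context d (T : measurableType d) (R : realType) (P : probability T R).
Context (xi : nat -> {RV P >-> int}) (zeta : int -> {RV P >-> R}).
Hypotheses (xi_iid : iid xi) (zeta_iid : iid zeta).
Hypothesis zeta_pos : forall k : int, {ae P, forall w, 0 < zeta k w}.
Hypothesis xi_zeta_indep : independent_families xi zeta.
Local Notation E := (Ex P).
Local Notation p := (pr P).
Local Notation x := (fun w k => xi k w).
Local Notation z := (fun w k => zeta k w).
Local Notation xiR := (fun w => (xi 0%N w)%:~R : R).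

Lemma min1_sum n (c : nat -> R) : (forall i, 0 <= c i) ->
  Num.min 1 (\sum_(i < n) c i) <= \sum_(i < n) Num.min 1 (c i).
Proof.
move=> c0; elim: n => [|n IH]; first by rewrite !big_ord0 ge_min lexx orbT.
rewrite !big_ord_recr/=; apply: le_trans (lerD IH (lexx _)).
have : 0 <= \sum_(i < n) c i by apply: sumr_ge0.
move: (\sum_(i < n) _) (c n) (c0 n) => A b b0 A0.
have [A1|A1] := leP A 1; have [b1|b1] := leP b 1; rewrite ge_min; apply/orP;
  by [right; lra|left; lra].
Qed.

Local Notation atrunc t := (tmean P (zeta 0) t^-1).

Lemma Ex_min1_zeta (t : R) j : 0 < t ->
  E (fun w => Num.min 1 (t^-1 * `|zeta j w|)) = atrunc t.
Proof.
move=> t0; have [_ idd] := zeta_iid.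
apply: (@Ex_ident _ _ _ P _ _ (zeta j) (zeta 0) (fun v => Num.min 1 (t^-1 * `|v|))).
- apply: measurable_minr; first exact: measurable_cst.
  by apply: measurable_funM; [exact: measurable_cst|exact: normr_measurable].
- by move=> v; rewrite le_min ler01 mulr_ge0// invr_ge0 ltW.
- by move=> B mB; exact: idd.
Qed.

Lemma atrunc_ge0 (t : R) : 0 < t -> 0 <= atrunc t.
Proof.
by move=> t0; apply: Ex_ge0 => w; rewrite le_min ler01 mulr_ge0// invr_ge0 ltW.
Qed.

Let mzeta k : measurable_fun setT (zeta k). Proof. exact: measurable_funP. Qed.

Let mcst (y : nat -> int) n : measurable_fibers (fun _ : T => y n).
Proof.
move=> k; have [->|e] := pselect (y n = k).
  by rewrite (_ : _ @^-1` _ = setT); [exact: measurableT|exact/seteqP].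
by rewrite (_ : _ @^-1` _ = set0); [exact: measurable0|apply/seteqP; split].
Qed.

(* Markov's inequality for the jump lengths truncated at t. Truncation inside
   each jump makes the bound useful when the bonds have infinite mean. *)
Lemma pr_sum_jumps_le (y : nat -> int) (Q : pred nat) n (t : R) : 0 < t ->
  p [set w | t < \sum_(k < n | Q k) `|wrm y (z w) k.+1 - wrm y (z w) k|]
    <= \sum_(k < n | Q k) Num.min 1 (atrunc t * `|(y k)%:~R|).
Proof.
move=> t0.
pose J k w := t^-1 * `|wrm y (z w) k.+1 - wrm y (z w) k|.
have J0 k w : 0 <= J k w by rewrite mulr_ge0// invr_ge0 ltW.
have mJ k : measurable_fun setT (J k).
  by apply: measurable_funM; [exact: measurable_cst|exact: (measurable_jump (mcst y) mzeta k)].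
have bJ k : bounded_rv (fun w => Num.min 1 (J k w)).
  split; first by apply: measurable_minr; [exact: measurable_cst|exact: mJ].
  by exists 1 => w; rewrite ger0_norm ?ge_min ?lexx// le_min ler01 J0.
pose f k w := if Q k then Num.min 1 (J k w) else 0.
have bf k : bounded_rv (f k).
  by rewrite /f; case: (Q k); [exact: bJ|exact: bounded_rv_cst].
have f0 k w : 0 <= f k w by rewrite /f; case: ifP => // _; rewrite le_min ler01 J0.
have mS : measurable [set w | t < \sum_(k < n | Q k) `|wrm y (z w) k.+1 - wrm y (z w) k|].
  exact: (generated_measurable (generated_sum_jumps y Q n t)).
have := @markov_pr _ _ _ P _ 1 _ (bounded_rv_sum n bf) ltr01 mS.
have S0 w : 0 <= \sum_(i < n) f i w by apply: sumr_ge0.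
rewrite divr1 => /(_ S0) H; apply: (le_trans (H _)).
  move=> w /= tw.
  pose c k := if Q k then J k w else 0.
  have c0 k : 0 <= c k by rewrite /c; case: ifP.
  have : 1 <= \sum_(k < n) c k.
    rewrite -[\sum_(k < n) c k]big_mkcond/= -mulr_sumr.
    by rewrite mulrC ler_pdivlMr// mul1r ltW.
  move=> /min_l <-; apply: (le_trans (min1_sum n c0)).
  by apply: ler_sum => k _; rewrite /c /f; case: (Q k) => //; rewrite ge_min lexx orbT.
rewrite Ex_sum// [leRHS]big_mkcond; apply: ler_sum => k _; rewrite /f.
case: (Q k); last by rewrite Ex_cst.
(* The bound 1 is kept beside the linear one: the walk steps are averaged later, and for beta = 1
   only their truncated mean is under control. *)
rewrite le_min; apply/andP; split.
  rewrite -[leRHS](Ex_cst P); apply: le_Ex => //; first exact: bounded_rv_cst.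
  by move=> w; rewrite ge_min lexx.
pose b := Num.min (walk y k) (walk y k + y k).
pose q j w := Num.min 1 (t^-1 * `|zeta (b + j.+1%:Z) w|).
have ti0 : 0 <= t^-1 by rewrite invr_ge0 ltW.
have bq j : bounded_rv (q j) by exact: bounded_rv_tmean.
apply: (@le_trans _ _ (E (fun w => \sum_(j < `|y k|%N) q j w))).
  apply: le_Ex => //; first exact: bounded_rv_sum.
  move=> w; have q0 j : 0 <= t^-1 * `|zeta (b + j.+1%:Z) w| by rewrite mulr_ge0.
  apply: le_trans (min1_sum _ q0).
  rewrite le_min !ge_min lexx/=; apply/orP; right.
  rewrite -mulr_sumr /J ler_wpM2l// /wrm walkS medium_jump.
  exact: ler_norm_sum.
rewrite Ex_sum// (eq_bigr (fun=> atrunc t)) => [|j _]; last exact: Ex_min1_zeta.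
by rewrite sumr_const card_ord -mulr_natr -intr_norm -abszE -pmulrn.
Qed.

Local Notation u := (pr_nonpos xi).
Local Notation F n := (steps xi (iota 0 n)).

Let mS s := measurable_steps s (measurable_fibers_xi xi).

Lemma measurable_event t : measurable [set w | (t%:E < first_passage_time (x w) (z w))%E].
Proof.
exact: (measurable_first_passage_time (measurable_fibers_xi xi) mzeta).
Qed.

Lemma nth_steps_eq n w l i : F n w = l -> (i < n)%N -> nth 0 l i = xi i w.
Proof. by move=> <- i_n; rewrite nth_steps. Qed.

Lemma pr_first_passage_le n (t : R) : 0 < t ->
  p [set w | (t%:E < first_passage_time (x w) (z w))%E] <=
  u n + (\sum_(k < n) u k) * tmean P xiR (atrunc t).
Proof.
move=> t0; set G := [set w | _]; have mG : measurable G by exact: measurable_event.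
have mN k : measurable [set w | nonpos_upto (x w) k] by exact: (measurable_nonpos_upto xi 0).
pose A := (G `&` all_pos zeta) `\` [set w | nonpos_upto (x w) n].
have mA : measurable A.
  by apply: measurableD => //; apply: measurableI => //; exact: measurable_all_pos.
apply: (@le_trans _ _ (u n + p A)).
  apply: le_trans (pr_setU _ (mN n) mA).
  apply: (le_pr_all_pos zeta_pos) => //; first exact: measurableU.
  move=> w [Gw Ow]; have [|/negP] := boolP (nonpos_upto (x w) n); first by left.
  by right.
rewrite lerD2l; set a := atrunc t; have a0 : 0 <= a by exact: atrunc_ge0.
pose g (y : int) : R := Num.min 1 (a * `|y%:~R|).
have g0 y : 0 <= g y by rewrite le_min ler01 mulr_ge0.
have g1 y : g y <= 1 by rewrite ge_min lexx.
(* The indicator depends on the steps before [k] only, so the expectation of [h k] factors. *)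
pose h k w : R := \1_[set w | nonpos_upto (x w) k] w * g (xi k w).
have h0 k w : 0 <= h k w by rewrite mulr_ge0.
have mg k : measurable_fun setT (fun w => g (xi k w)).
  apply: (measurable_fun_fibers (g := fun y _ => g y) (measurable_fibers_xi xi k)).
  by move=> y; exact: measurable_cst.
have bh k : bounded_rv (h k).
  split; first by apply: measurable_funM; [exact: measurable_indic|exact: mg].
  exists 1 => w; rewrite ger0_norm// /h indicE; case: (_ \in _).
    by rewrite mul1r.
  by rewrite mul0r ler01.
have Eh k : E (h k) = u k * tmean P xiR a.
  rewrite /h (@Ex_indep_fibers _ _ _ _ _ _ _ g 1)//.
  - congr (_ * _); have [_ idd] := xi_iid.
    apply: (@Ex_ident _ _ _ P _ _ (xi k) (xi 0%N) g) => //.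
    by move=> B mB; exact: idd.
  - exact: measurable_fibers_xi.
  - by move=> y; rewrite g0 g1.
  - move=> y; have -> : xi k @^-1` [set y] = steps xi [:: k] @^-1` [set [:: y]].
      by apply/seteqP; split=> w /= => [->|[]].
    have := nonpos_upto_steps xi 0 k; rewrite -[mkset _]/[set w | nonpos_upto (x w) k] => ->.
    by rewrite steps_indep// cat_uniq iota_uniq/= mem_iota ltnn.
have -> : (\sum_(k < n) u k) * tmean P xiR a = E (fun w => \sum_(k < n) h k w).
  by rewrite Ex_sum// mulr_suml; apply: eq_bigr => k _; rewrite Eh.
rewrite -lee_fin -prE// -ExE; last exact: bounded_rv_sum.
have bsum := bounded_rv_sum n bh.
(* On a fiber the integrand is a constant [c]. The event is contained there in one about the medium
   and the fixed path [y], of probability at most [c] and independent of the fiber. *)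
apply: (le_integral_fibers (mS (iota 0 n))) => //.
- by apply/measurable_EFinP; case: bsum.
- by move=> w; rewrite lee_fin sumr_ge0.
move=> l; pose y := nth 0 l; set D := F n @^-1` [set l].
pose c := \sum_(k < n | nonpos_upto y k) g (y k).
have mD : measurable D by exact: mS.
rewrite (eq_integral (cst c%:E)); last first.
  move=> w /set_mem wD; congr EFin.
  rewrite /c [RHS]big_mkcond; apply: eq_bigr => k _; rewrite /h indicE.
  have -> : (w \in [set w | nonpos_upto (x w) k]) = nonpos_upto y k.
    rewrite (@nonpos_upto_eq y (x w)) => [|i ik].
      by apply/idP/idP => [/set_mem//|]; rewrite inE.
    by rewrite /y (nth_steps_eq wD)//; exact: ltn_trans ik _.
  rewrite /y (nth_steps_eq wD)//.
  by case: (nonpos_upto _ _); rewrite ?mul1r ?mul0r.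
rewrite integral_cst//.
pose H := [set w | t < \sum_(k < n | nonpos_upto y k) `|wrm y (z w) k.+1 - wrm y (z w) k|].
have gH : generated_sigma_algebra zeta H by exact: generated_sum_jumps.
have mH := generated_measurable gH.
apply: (@le_trans _ _ (P (D `&` H))).
  apply: le_measure; rewrite ?inE; [exact: measurableI|exact: measurableI|].
  move=> w [[[Gw Ow] nw] Dw]; split => //.
  have [xn|] := first_passage_time_cases n Ow Gw; first by case: (nw xn).
  rewrite /H /= => /lt_le_trans; apply.
  have xy i : (i < n)%N -> y i = x w i by move=> i_n; rewrite /y (nth_steps_eq Dw).
  rewrite le_eqVlt; apply/orP; left; apply/eqP; apply: eq_big => k.
    by rewrite (@nonpos_upto_eq y (x w))// => i ik; apply: xy; exact: ltn_trans ik _.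
  by move=> _; rewrite /wrm !(@walk_eq y (x w) n)// ltnW.
have -> : (P (D `&` H) = P D * P H)%E by apply: xi_zeta_indep => //; exact: generated_steps.
suff : (P D * P H <= c%:E * P D)%E by [].
rewrite muleC lee_wpmul2r// (prE P mH) lee_fin; exact: pr_sum_jumps_le.
Qed.

End upper_bound.

(** * Lower bounds at a fixed time *)

Section lower_bound.
Context d (T : measurableType d) (R : realType) (P : probability T R).
Context (xi : nat -> {RV P >-> int}) (zeta : int -> {RV P >-> R}).
Hypothesis zeta_iid : iid zeta.
Hypothesis zeta_pos : forall k : int, {ae P, forall w, 0 < zeta k w}.
Hypothesis xi_zeta_indep : independent_families xi zeta.
Local Notation E := (Ex P).
Local Notation p := (pr P).
Local Notation x := (fun w k => xi k w).
Local Notation z := (fun w k => zeta k w).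

Let mzeta k : measurable_fun setT (zeta k). Proof. exact: measurable_funP. Qed.
Let mxi := measurable_fibers_xi xi.

Let mlt0 : measurable (xi 0%N @^-1` [set k | k < 0]).
Proof. exact: (measurable_preimage_countable (mxi 0)). Qed.

Lemma measurable_zeta_gt k (t : R) : measurable [set w | t < zeta k w].
Proof. by apply: measurable_set_lt => //; exact: measurable_cst. Qed.

Lemma measurable_zeta_lt k (t : R) : measurable [set w | zeta k w < t].
Proof. by apply: measurable_set_lt => //; exact: measurable_cst. Qed.

Lemma pr_zeta_lt_ident k (t : R) :
  p [set w | zeta k w < t] = p [set w | zeta 0 w < t].
Proof.
have [_ idd] := zeta_iid.
have := idd k 0 `]-oo, t[%classic (measurable_itv _).
rewrite /distribution /pushforward /pr.
have e j : zeta j @^-1` `]-oo, t[%classic = [set w | zeta j w < t].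
  by apply/seteqP; split=> w /=; rewrite in_itv.
by rewrite !e => ->.
Qed.

(** Continuity from above along [1/(n+1)]. The value 1/4 is half of the fraction 1/2 used in
    [pr_collision_time_ge], so that Markov's inequality yields 1/2 there. *)
Lemma exists_zeta_lt_small : exists2 eta : R, 0 < eta &
  p [set w | zeta 0 w < eta] <= 4^-1.
Proof.
pose F n := [set w | zeta 0 w < n.+1%:R^-1] `&` all_pos zeta.
have mF n : measurable (F n).
  by apply: measurableI; [exact: measurable_zeta_lt|exact: measurable_all_pos].
have F0 : \bigcap_n F n = set0.
  apply/seteqP; split=> w //= h.
  have [_ /(_ 0) w0] := h 0%N I.
  have wi : 0 <= (zeta 0 w)^-1 by rewrite invr_ge0 ltW.
  have [+ _] := h (Num.bound (zeta 0 w)^-1) I; rewrite /=.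
  rewrite -[ltLHS]invrK ltf_pV2 ?posrE ?invr_gt0// ltNge => /negP; apply.
  by apply/ltW/(lt_le_trans (archi_boundP wi)); rewrite ler_nat.
have P0 : (P (F 0%N) < +oo)%E by rewrite (prE P (mF 0%N)) ltry.
have mI : measurable (\bigcap_n F n) by rewrite F0.
have dF : nonincreasing_seq F.
  move=> m n mn; apply/subsetPset => w [h Ow]; split => //; move: h => /= /lt_le_trans.
  by apply; rewrite lef_pV2 ?posrE// ler_nat.
have := nonincreasing_cvg_mu P0 mF mI dF.
rewrite F0 measure0 => /fine_cvgP[_] cv.
have e0 : (0 : R) < 4^-1 by rewrite invr_gt0.
have [N _ /(_ N (leqnn N))] := (cvgr0Pnorm_lt _).1 cv _ e0.
rewrite /= ger0_norm ?fine_ge0// => /ltW h.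
exists N.+1%:R^-1; first by rewrite invr_gt0.
by apply: le_trans h; apply: (le_pr_all_pos zeta_pos) => //; exact: measurable_zeta_lt.
Qed.

Lemma medium_jump_ge (v : int -> R) (k y : int) : (forall j, 0 < v j) -> y != 0 ->
  v (Num.min k (k + y) + 1) <= `|medium v (k + y) - medium v k|.
Proof.
move=> v0 y0; rewrite medium_jump.
have : (0 < `|y|%N)%N by rewrite absz_gt0.
case: (absz y) => // n _; rewrite big_ord_recl/= ger0_norm; last first.
  by rewrite addr_ge0 ?sumr_ge0// => *; exact: ltW.
by rewrite lerDl sumr_ge0// => *; exact: ltW.
Qed.

(* Each nonzero jump crosses the bond [b k]; by Markov's inequality, with
   probability at least 1/2, at least half of these bonds are longer than eta. *)
Lemma pr_collision_time_ge (y : nat -> int) n (eta t : R) : 0 < eta ->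
  p [set w | zeta 0 w < eta] <= 4^-1 ->
  0 < \sum_(k < n) (y k != 0)%:R :> R ->
  2 * t <= eta * \sum_(k < n) (y k != 0)%:R ->
  2^-1 <= p [set w | t < collision_time y (z w) n].
Proof.
move=> eta0 heta; set m : R := \sum_(k < n) _ => m0 ht.
pose b k := Num.min (walk y k) (walk y k + y k) + 1.
pose V k w : R := (y k != 0)%:R * \1_[set w | zeta (b k) w < eta] w.
pose W w : R := \sum_(k < n) V k w.
have bI k : bounded_rv (V k).
  by apply: bounded_rvZ; apply: bounded_rv_indic; exact: measurable_zeta_lt.
have bW : bounded_rv W by exact: bounded_rv_sum bI.
have W0 w : 0 <= W w by apply: sumr_ge0 => k _; rewrite mulr_ge0.
(* Different steps may cross the same bond, so the indicators can be dependent; linearity of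
   expectation copes with this. *)
have EW : E W <= m / 4.
  rewrite /W Ex_sum// /m mulr_suml; apply: ler_sum => k _.
  rewrite /V ExZ; last by apply: bounded_rv_indic; exact: measurable_zeta_lt.
  rewrite Ex_indic; last exact: measurable_zeta_lt.
  by rewrite pr_zeta_lt_ident ler_wpM2l.
have mA : measurable [set w | m / 2 <= W w].
  by apply: measurable_set_le; [exact: measurable_cst|case: bW].
have m20 : 0 < m / 2 by rewrite divr_gt0.
have pA : p [set w | m / 2 <= W w] <= 2^-1.
  apply: (le_trans (@markov_pr _ _ _ P _ _ _ bW m20 mA W0 (fun w h => h))).
  by rewrite ler_pdivrMr//; move: EW; lra.
have mH : measurable [set w | t < collision_time y (z w) n].
  exact: (generated_measurable (generated_collision_time y n t)).
have : 1 - p [set w | m / 2 <= W w] <= p [set w | t < collision_time y (z w) n].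
  rewrite -pr_setC//; apply: (le_pr_all_pos zeta_pos) => //; first exact: measurableC.
  move=> w [/= /negP Wm Ow]; rewrite -ltNge in Wm.
  have : eta * (m - W w) <= collision_time y (z w) n.
    rewrite /m /W -sumrB mulr_sumr; apply: ler_sum => k _; rewrite /V indicE.
    have [_|yk] := eqVneq (y k) 0; first by rewrite /= mul0r subrr mulr0.
    rewrite /= mul1r /wrm walkS; apply: le_trans (medium_jump_ge _ Ow yk).
    rewrite -/(b k); have [h|h] := boolP (_ \in _).
      by rewrite subrr mulr0 ltW.
    rewrite subr0 mulr1 leNgt; apply: contra h => h.
    by rewrite inE.
  apply: lt_le_trans; apply: (le_lt_trans (y := eta * (m / 2))); first by move: ht; lra.
  by rewrite ltr_pM2l//; move: Wm; lra.
by move: pA; lra.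
Qed.

Local Notation F n := (steps xi (iota 0 n)).
Let mS s := measurable_steps s mxi.
Let G t := [set w | (t%:E < first_passage_time (x w) (z w))%E].
Let mG t : measurable (G t). Proof. exact: measurable_event. Qed.

(** On each fiber contained in the left-hand event, the collision time exceeds [t] with probability
    at least 1/2, whence the factor 2. *)
Lemma pr_first_passage_ge_nonpos n r (eta t : R) : 0 < eta ->
  p [set w | zeta 0 w < eta] <= 4^-1 -> 2 * t <= eta * r%:R ->
  p ([set w | nonpos_upto (x w) n] `\`
     [set w | (count (predC1 0%R) (F n w) <= r)%N]) <= 2 * p (G t).
Proof.
move=> eta0 heta ht.
have mC := measurable_preimage_countable (mS (iota 0 n))
  [set l | (count (predC1 0%R) l <= r)%N].
set A := _ `\` _; have mA : measurable A.
  by apply: measurableD => //; exact: (measurable_nonpos_upto xi 0).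
rewrite -lee_fin EFinM -!prE//.
apply: (le_measure_fibers (mS (iota 0 n)) (mS (iota 0 n))) => // l.
set D := F n @^-1` [set l]; have mD : measurable D by exact: mS.
(* [A] depends on the first [n] steps only, so a single point [w0] of the fiber transfers its
   properties to the path [y]. *)
have [->|/set0P[w0 [[A1 /negP A2] Dw0]]] := eqVneq (A `&` D) set0.
  by rewrite measure0 mule_ge0.
pose y := nth 0 l.
have xy w i : D w -> (i < n)%N -> y i = x w i.
  by move=> Dw i_n; rewrite /y (nth_steps_eq Dw).
have sl : size l = n by have <- : F n w0 = l := Dw0; rewrite size_map size_iota.
have yn : nonpos_upto y n by rewrite (@nonpos_upto_eq y (x w0))// => i; exact: xy.
have rl : r%:R < \sum_(k < n) (y k != 0)%:R :> R.
  rewrite -natr_sum ltr_nat.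
  rewrite (_ : (\sum_(k < n) _)%N = count (predC1 0%R) l).
    by have <- : F n w0 = l := Dw0; rewrite ltnNge.
  rewrite -sum1_count [RHS]big_mkcond [RHS](big_nth 0) sl [RHS]big_mkord.
  by apply: eq_bigr => k _; rewrite /y /=; case: eqP.
have r0 : 0 <= r%:R :> R by [].
pose H := [set w | t < collision_time y (z w) n].
have gH : generated_sigma_algebra zeta H by exact: generated_collision_time.
have mH := generated_measurable gH.
have pH : 2^-1 <= p H.
  apply: (pr_collision_time_ge eta0 heta); first exact: le_lt_trans rl.
  by apply: (le_trans ht); rewrite ler_pM2l// ltW.
have pDH : p (D `&` H) = p D * p H.
  apply: EFin_inj; rewrite EFinM -!prE//; last exact: measurableI.
  by apply: xi_zeta_indep => //; exact: generated_steps.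
have h1 : p (D `&` H) <= p (G t `&` D).
  apply: (le_pr_all_pos zeta_pos); [exact: measurableI|exact: measurableI|].
  move=> w [[Dw Hw] Ow]; split => //.
  have xyw := xy w _ Dw.
  apply: (@first_passage_time_gt _ (x w) (z w) t n Ow).
    by rewrite (@nonpos_upto_eq (x w) y)// => i i_n; rewrite xyw.
  move: Hw; rewrite /H /= => /lt_le_trans; apply.
  rewrite le_eqVlt; apply/orP; left; apply/eqP; apply: eq_bigr => k _.
  by rewrite /wrm !(@walk_eq y (x w) n)// ltnW.
suff : (P (A `&` D) <= 2%:E * P (G t `&` D))%E by [].
apply: (@le_trans _ _ (P D)); first by apply: le_measure; rewrite ?inE//; exact: measurableI.
rewrite !prE//; last exact: measurableI.
rewrite -EFinM lee_fin; have := pr_ge0 P D; move: pDH h1 pH.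
move: (p H) (p D) (p (D `&` H)) (p (G t `&` D)) => ph pd pdh pg e h1 h2 h3.
have : pd * 2^-1 <= pd * ph by rewrite ler_wpM2l.
by rewrite -e; lra.
Qed.

(** A first step to the left, whatever its length, crosses bond 0, which joins the sites -1 and
    0. *)
Lemma pr_first_passage_ge_step (t : R) :
  p (xi 0%N @^-1` [set k | k < 0]) * p [set w | t < zeta 0 w] <= p (G t).
Proof.
have mZ := measurable_zeta_gt 0 t.
have -> : p (xi 0%N @^-1` [set k | k < 0]) * p [set w | t < zeta 0 w] =
    p (xi 0%N @^-1` [set k | k < 0] `&` [set w | t < zeta 0 w]).
  apply/esym/EFin_inj; rewrite EFinM -!prE//; last exact: measurableI.
  apply: xi_zeta_indep.
    have -> : xi 0%N @^-1` [set k | k < 0] =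
        steps xi [:: 0%N] @^-1` [set l | nth 0 l 0%N < 0] by [].
    exact: generated_steps.
  apply: sub_sigma_algebra; exists 0, `]t, +oo[%classic; split; first exact: measurable_itv.
  by apply/seteqP; split=> w /=; rewrite in_itv/= andbT.
apply: (le_pr_all_pos zeta_pos); [exact: measurableI|exact: mG|].
move=> w [[/= x0 zt] Ow]; apply: (@first_passage_time_gt _ (x w) (z w) t 1 Ow).
  apply/nonpos_uptoP => -[|[|//]] _; first by rewrite walk0.
  by rewrite walkS walk0 add0r ltW.
apply: (lt_le_trans zt); rewrite collision_timeS /collision_time big_ord0 add0r.
rewrite /wrm walkS walk0 add0r medium0 subr0.
case: (xi 0%N w) x0 => // n _ /=; rewrite normrN ger0_norm; last first.
  by apply: sumr_ge0 => *; exact: ltW.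
by rewrite big_ord_recl/= oppr0 lerDl sumr_ge0// => *; exact: ltW.
Qed.

End lower_bound.
(** * Asymptotics *)

Section walk_tails.
Context d (T : measurableType d) (R : realType) (P : probability T R).
Context (xi : nat -> {RV P >-> int}) (beta : R).
Hypotheses (xi_iid : iid xi) (xi_sym : symmetric_rv (xi 0%N)).
Hypothesis xi_attr : walk_attraction P beta (fun w => (xi 0%N w)%:~R).
Local Notation p := (pr P).
Local Notation xiR := (fun w => (xi 0%N w)%:~R : R).

Let mxi := measurable_fibers_xi xi.

Lemma measurable_xiR : measurable_fun setT xiR.
Proof.
pose g (k : int) (_ : T) : R := k%:~R.
have mg k : measurable_fun setT (g k) by exact: measurable_cst.
exact: (measurable_fun_fibers (mxi 0%N) mg).
Qed.

Lemma phi_xi_equiv : exists nu dlt : R, [/\ 0 < nu, 0 < dlt &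
  forall s, 0 < s <= dlt -> nu / 2 * s `^ beta <= phi P xiR s <= 2 * nu * s `^ beta].
Proof.
have [nu nu0 h] := xi_attr.
have [|dlt d0 hd] := phi_equiv measurable_xiR nu0 _ h; first by move=> s.
by exists nu, dlt.
Qed.

Lemma pr_xi_gt0 : p (xi 0%N @^-1` [set k | 0 < k]) = p (xi 0%N @^-1` [set k | k < 0]).
Proof.
have := steps_oppr_law xi_iid xi_sym [set l | 0 < nth 0 l 0%N] (s := [:: 0%N]) isT.
have -> : steps (fun k w => - xi k w) [:: 0%N] @^-1` [set l | 0 < nth 0 l 0%N] =
    xi 0%N @^-1` [set k | k < 0].
  by apply/seteqP; split=> w; rewrite /preimage /= oppr_gt0.
by have -> : xi 0%N @^-1` [set k | 0 < k] =
  steps xi [:: 0%N] @^-1` [set l | 0 < nth 0 l 0%N] by [].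
Qed.

(** [1 - cos] vanishes on a zero step and is at most 2 otherwise, while [phi] is positive at
    [dlt]. *)
Lemma pr_xi_neq0_gt0 : 0 < p (xi 0%N @^-1` [set k | k != 0]).
Proof.
have [nu [dlt [nu0 d0 h]]] := phi_xi_equiv.
have mA : measurable (xi 0%N @^-1` [set k | k != 0]).
  exact: (measurable_preimage_countable (mxi 0%N)).
have /andP[h1 _] : nu / 2 * dlt `^ beta <= phi P xiR dlt <= 2 * nu * dlt `^ beta.
  by apply: h; rewrite d0 lexx.
have : phi P xiR dlt <= 2 * p (xi 0%N @^-1` [set k | k != 0]).
  rewrite -Ex_indic// -ExZ; last exact: bounded_rv_indic.
  apply: le_Ex => [||w]; first exact: bounded_rv_oneBcos measurable_xiR _.
    by apply: bounded_rvZ; exact: bounded_rv_indic.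
  rewrite /oneBcos indicE; have [w0|w0] := boolP (w \in _).
    by rewrite mulr1; have := cos_geN1 (dlt * (xi 0%N w)%:~R); lra.
  have -> : xi 0%N w = 0.
    by apply/eqP; apply: contraNT w0 => w0; rewrite inE.
  by rewrite mulr0z mulr0 cos0 subrr mulr0.
have : 0 < nu / 2 * dlt `^ beta by rewrite mulr_gt0 ?powR_gt0// divr_gt0.
by move: h1; lra.
Qed.

Lemma pr_xi_lt0_gt0 : 0 < p (xi 0%N @^-1` [set k | k < 0]).
Proof.
have mA B : measurable (xi 0%N @^-1` B).
  exact: (measurable_preimage_countable (mxi 0%N)).
have : p (xi 0%N @^-1` [set k | k != 0]) <=
    p (xi 0%N @^-1` [set k | 0 < k]) + p (xi 0%N @^-1` [set k | k < 0]).
  apply: le_trans (pr_setU _ (mA _) (mA _)); apply: le_pr => //.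
    exact: measurableU.
  by move=> w; rewrite /preimage /= neq_lt => /orP[|]; [right|left].
by rewrite pr_xi_gt0; have := pr_xi_neq0_gt0; lra.
Qed.

Lemma tail_xi_le : 0 < beta ->
  exists2 K, 0 < K & forall a, 0 < a -> tail P xiR a <= K * a `^ beta.
Proof.
move=> b0; have [nu [dlt [nu0 d0 h]]] := phi_xi_equiv.
have nu20 : 0 < 2 * nu by rewrite mulr_gt0.
apply: (tail_le measurable_xiR b0 nu20 d0) => s sd.
by have /andP[] := h s sd.
Qed.

End walk_tails.

Section medium_tails.
Context d (T : measurableType d) (R : realType) (P : probability T R).
Context (zeta : int -> {RV P >-> R}) (gamma : R).
Hypotheses (zeta_iid : iid zeta) (gamma0 : 0 < gamma) (gamma1 : gamma != 1).
Hypothesis zeta_pos : forall k : int, {ae P, forall w, 0 < zeta k w}.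
Hypothesis zeta_attr : medium_attraction P gamma zeta.
Local Notation p := (pr P).

Let mzeta k : measurable_fun setT (zeta k). Proof. exact: measurable_funP. Qed.

(** Ensures that the real part of the characteristic function of a bond already has a term of order
    [s ^ gamma]. *)
Lemma cos_stable_phase_gt0 : gamma < 1 -> 0 < cos (pi * gamma / 2).
Proof.
move=> g1; apply: cos_gt0_pihalf.
have pi0 := @pi_gt0 R.
have h1 : 0 < pi * gamma by rewrite mulr_gt0.
have h2 : pi * gamma < pi * 1 by rewrite ltr_pM2l.
by apply/andP; split; lra.
Qed.

Lemma phi_zeta_equiv : gamma < 1 -> exists c dlt : R, [/\ 0 < c, 0 < dlt &
  forall s, 0 < s <= dlt ->
    c / 2 * s `^ gamma <= phi P (zeta 1) s <= 2 * c * s `^ gamma].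
Proof.
move=> g1; have [c c0 h] := zeta_attr.1 g1.
have cc0 : 0 < c * cos (pi * gamma / 2) by rewrite mulr_gt0// cos_stable_phase_gt0.
have [|dlt d0 hd] := phi_equiv (mzeta 1) cc0 _ h; last by exists (c * cos (pi * gamma / 2)), dlt.
by move=> s; rewrite /stable_phase /=; ring.
Qed.

(** The attraction hypothesis is stated for bond 1, the path estimates for bond 0. *)
Lemma tmean_zeta_eq a : 0 < a -> tmean P (zeta 0) a = tmean P (zeta 1) a.
Proof.
move=> a0; have t0 : 0 < a^-1 by rewrite invr_gt0.
by have := Ex_min1_zeta zeta_iid 1 t0; rewrite invrK => <-.
Qed.

Lemma tmean_zeta_le : exists2 A, 0 < A &
  forall t : R, 0 < t -> tmean P (zeta 0) t^-1 <= A * t `^ (- Num.min 1 gamma).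
Proof.
have [g1|g1|g1] := ltgtP gamma 1; last by move: gamma1; rewrite g1 eqxx.
- have [c [dlt [c0 d0 h]]] := phi_zeta_equiv g1.
  have c20 : 0 < 2 * c by rewrite mulr_gt0.
  have [K K0 hK] : exists2 K, 0 < K &
      forall a, 0 < a -> tail P (zeta 1) a <= K * a `^ gamma.
    by apply: (tail_le (mzeta 1) gamma0 c20 d0) => s sd; have /andP[] := h s sd.
  have [A A0 hA] := tmean_le_lt1 (mzeta 1) gamma0 K0 hK g1.
  exists A => // t t0; rewrite tmean_zeta_eq ?invr_gt0//.
  apply: (le_trans (hA _ _)); first by rewrite invr_gt0.
  by rewrite -powR_inv1 ?(ltW t0)// -powRrM mulN1r.
- have [mu mu0 [it _ _]] := zeta_attr.2 g1.
  have bound t : 0 < t -> tmean P (zeta 0) t^-1 <= t^-1 * \int[P]_w `|zeta 1 w|.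
    move=> t0; rewrite tmean_zeta_eq ?invr_gt0//.
    have iN : P.-integrable setT (EFin \o (fun w => `|zeta 1 w|)).
      exact: integrable_norm.
    rewrite -RintegralZl//; apply: le_Rintegral => //.
    + apply: bounded_rv_integrable; apply: bounded_rv_tmean => //.
      by rewrite invr_ge0 ltW.
    + exact: (integrableZl measurableT t^-1 iN).
    + by move=> w _; rewrite ge_min lexx orbT.
  have M0 : 0 <= \int[P]_w `|zeta 1 w| by apply: Rintegral_ge0.
  exists (\int[P]_w `|zeta 1 w| + 1); first by rewrite ltr_wpDl.
  move=> t t0; apply: (le_trans (bound t t0)).
  rewrite powR_inv1 ?(ltW t0)// mulrC ler_wpM2r ?invr_ge0 ?(ltW t0)//.
  by rewrite lerDl.
Qed.

Lemma pr_zeta_gt_ge : gamma < 1 -> exists2 K, 0 < K & exists t0 : R, forall t, t0 <= t ->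
  K * t `^ (- gamma) <= p [set w | t < zeta 0 w].
Proof.
move=> g1; have [c [dlt [c0 d0 h]]] := phi_zeta_equiv g1.
have g01 : 0 < gamma < 1 by rewrite gamma0.
have c20 : 0 < c / 2 by rewrite divr_gt0.
have C20 : 0 < 2 * c by rewrite mulr_gt0.
have [K K0 hK] := tail_ge (mzeta 1) g01 c20 C20 d0 h.
exists K => //; exists dlt^-1 => t td; apply: (le_trans (hK t td)).
have [_ idd] := zeta_iid.
have -> : p [set w | t < zeta 0 w] = p [set w | t < zeta 1 w].
  have := idd 0 1 `]t, +oo[%classic (measurable_itv _).
  rewrite /distribution /pushforward /pr.
  have e j : zeta j @^-1` `]t, +oo[%classic = [set w | t < zeta j w].
    by apply/seteqP; split=> w /=; rewrite in_itv/= andbT.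
  by rewrite !e => ->.
apply: (le_pr_all_pos zeta_pos); last by move=> w [/= h1 /(_ 1)/gtr0_norm <-].
- by apply: measurable_set_lt; [exact: measurableT_comp|exact: measurable_cst].
- by apply: measurable_set_lt; [exact: mzeta|exact: measurable_cst].
Qed.

End medium_tails.
Section slow_variation.
Context {R : realType}.

Lemma slowly_varying_cst (k : R) : 0 < k -> slowly_varying (fun=> k).
Proof.
move=> k0; split; first by exists 0; split=> //; exact: measurable_cst.
by move=> l l0; rewrite divff ?gt_eqF//; exact: cvg_cst.
Qed.

Lemma slowly_varying_ln (k : R) : 0 < k -> slowly_varying (fun t => k * ln t).
Proof.
move=> k0; split.
  exists 2; split=> [t t2|]; first by rewrite mulr_gt0// ln_gt0//; lra.
  by apply: measurable_funM; [exact: measurable_cst|exact: measurable_funTS].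
move=> l l0; apply/cvgrPdist_le => e e0.
have b0 : 0 <= `|ln l| / e by rewrite divr_ge0// ltW.
(* The error is [|ln l| / ln t], at most [e] from here on; the [+ 1] keeps [ln t] positive. *)
apply: filterS (nbhs_pinfty_ge (num_real (expR (`|ln l| / e + 1)))) => t ht.
have t0 : 0 < t by apply: lt_le_trans ht; exact: expR_gt0.
have lt : `|ln l| / e + 1 <= ln t.
  by rewrite -[leLHS]expRK ler_ln ?posrE ?expR_gt0.
have lt0 : 0 < ln t by apply: lt_le_trans lt; rewrite ltr_wpDl.
rewrite lnM ?posrE// (_ : 1 - _ = - (ln l / ln t)); last first.
  by field; rewrite !gt_eqF.
rewrite normrN normrM normfV (gtr0_norm lt0) ler_pdivrMr// mulrC -ler_pdivrMr//.
by apply: le_trans lt; rewrite lerDl.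
Qed.

End slow_variation.

Section asymptotics.
Context d (T : measurableType d) (R : realType) (P : probability T R).
Context (xi : nat -> {RV P >-> int}) (zeta : int -> {RV P >-> R}).
Context (beta gamma : R).
Hypotheses (xi_iid : iid xi) (xi_sym : symmetric_rv (xi 0%N)).
Hypothesis xi_attr : walk_attraction P beta (fun w => (xi 0%N w)%:~R).
Hypotheses (zeta_iid : iid zeta).
Hypothesis zeta_pos : forall k : int, {ae P, forall w, 0 < zeta k w}.
Hypothesis zeta_attr : medium_attraction P gamma zeta.
Hypothesis xi_zeta_indep : independent_families xi zeta.
Hypotheses (gamma0 : 0 < gamma) (gamma1 : gamma != 1).

Local Notation p := (pr P).
Local Notation u := (pr_nonpos xi).
Local Notation xiR := (fun w => (xi 0%N w)%:~R : R).
Local Notation g := (Num.min 1 gamma).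

Let G t := [set w | (t%:E < first_passage_time (fun n => xi n w) (fun k => zeta k w))%E].
Let c : R := p (xi 0%N @^-1` [set k | k < 0]).
Let c0 : 0 < c. Proof. exact: (pr_xi_lt0_gt0 xi_iid xi_sym xi_attr). Qed.
Let g0 : 0 < g. Proof. by rewrite lt_min ltr01. Qed.
Let mX := measurable_xiR xi.

Lemma pr_first_passage_ge_half : exists2 K, 0 < K & exists t0 : R,
  forall t, t0 <= t -> K * t `^ (- 2^-1) <= p (G t).
Proof.
have [eta eta0 heta] := exists_zeta_lt_small zeta_pos.
pose rho : R := p (xi 0%N @^-1` [set k | k != 0]).
have rho0 : 0 < rho by exact: pr_xi_neq0_gt0 xi_attr.
have rho1 : rho <= 1.
  by apply: pr_le1; exact: (measurable_preimage_countable (measurable_fibers_xi xi 0)).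
pose th := 1 - rho / 2.
have th0 : 0 <= th by rewrite /th; lra.
(* Among [B r] steps, having at most [r] nonzero ones then has probability at most
   [(2 th^B)^r <= 2^(-r)]. *)
have [B hB] : exists B, th ^+ B <= 4^-1.
  have e0 : (0 : R) < 4^-1 by rewrite invr_gt0.
  have r1 : `|th| < 1 by rewrite ger0_norm// /th; lra.
  have /cvgr0Pnorm_lt/(_ _ e0) [N _ hN] := cvg_expr r1.
  by exists N; have := hN N (leqnn N); rewrite /= ger0_norm ?exprn_ge0// => /ltW.
pose sB : R := Num.sqrt B.+1%:R.
have sB0 : 0 < sB by rewrite sqrtr_gt0.
pose c' := c / (4 * sB); have c'0 : 0 < c' by rewrite divr_gt0// mulr_gt0.
pose D := 2 / eta + 2; have D0 : 0 < D by rewrite addr_gt0// divr_gt0.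
exists (c' / (4 * Num.sqrt D)); first by rewrite divr_gt0// mulr_gt0// sqrtr_gt0.
(* [t >= 1] absorbs the rounding in [r.+1 <= D t]; the second threshold yields [s >= 2 / c']. *)
exists (Num.max 1 (eta / 2 * (2 / c') ^+ 2)) => t; rewrite ge_max => /andP[t1 t2].
have t0 : 0 < t by lra.
pose r := (Num.truncn (2 * t / eta)).+1.
have y0 : 0 <= 2 * t / eta by rewrite divr_ge0 ?mulr_ge0// ltW.
have hr : 2 * t <= eta * r%:R.
  by rewrite [leRHS]mulrC -ler_pdivrMr//; apply/ltW; exact: truncnS_gt.
have hr1 : r.+1%:R <= D * t.
  have : (Num.truncn (2 * t / eta))%:R <= 2 * t / eta by rewrite truncn_le.
  have -> : r.+1%:R = (Num.truncn (2 * t / eta))%:R + 2 :> R.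
    by rewrite /r -addn2 natrD.
  have -> : D * t = 2 * t / eta + 2 * t by rewrite /D; ring.
  by move: t1; lra.
pose s : R := Num.sqrt r.+1%:R; have s0 : 0 < s by rewrite sqrtr_gt0.
have hs1 : s <= Num.sqrt D * Num.sqrt t.
  by rewrite -sqrtrM ?(ltW D0)// ler_sqrt// mulr_ge0// ltW.
have hs2 : 2 / c' <= s.
  have -> : 2 / c' = Num.sqrt ((2 / c') ^+ 2).
    by rewrite sqrtr_sqr ger0_norm// divr_ge0// ltW.
  rewrite ler_sqrt//.
  have : eta / 2 * (2 / c') ^+ 2 <= eta / 2 * r%:R by move: t2 hr; lra.
  rewrite ler_pM2l ?divr_gt0// => /le_trans; apply.
  by rewrite ler_nat.
have hC := pr_few_steps xi_iid (B * r) r.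
have mN : measurable [set w | nonpos_upto (fun k => xi k w) (B * r)].
  exact: (measurable_nonpos_upto xi 0).
have mC : measurable [set w | (count (predC1 0%R) (steps xi (iota 0 (B * r)) w) <= r)%N].
  exact: (measurable_preimage_countable (measurable_steps (iota 0 (B * r))
    (measurable_fibers_xi xi)) [set l | (count (predC1 0%R) l <= r)%N]).
have hG := pr_first_passage_ge_nonpos zeta_iid zeta_pos xi_zeta_indep
  (B * r) eta0 heta hr.
have hu := pr_nonpos_ge xi_iid xi_sym c0 (B * r).
have hfew : 2 ^+ r * th ^+ (B * r) <= s ^- 2.
  rewrite exprM -exprMn; apply: (@le_trans _ _ (2^-1 ^+ r)).
    by apply: lerXn2r; rewrite ?nnegrE ?mulr_ge0 ?exprn_ge0//; move: hB; lra.
  rewrite sqr_sqrtr// exprVn lef_pV2 ?posrE ?exprn_gt0// -natrX ler_nat.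
  exact: ltn_expl.
have hu2 : c' / s <= u (B * r).
  apply: le_trans hu; rewrite /c' -mulrA -invfM ler_pM2l// lef_pV2 ?posrE ?mulr_gt0 ?sqrtr_gt0//.
  rewrite -mulrA ler_pM2l// /sB /s -sqrtrM// ler_sqrt// -natrM ler_nat.
  by rewrite mulSn mulnS addSn ltnS addnA leq_addl.
have hsplit : u (B * r) <= 2 * p (G t) + s ^- 2.
  apply: le_trans (lerD hG (le_trans hC hfew)).
  apply: le_trans (pr_setU _ (measurableD mN mC) mC).
  apply: le_pr => //; first by apply: measurableU => //; exact: measurableD.
  by move=> w Nw; have [|] := pselect ((count (predC1 0%R) (steps xi (iota 0 (B * r)) w)
    <= r)%N); [right|left].
(* The discarded walks cost at most half of the persistence probability [c' / s]. *)
have h1 : s ^- 2 <= c' / (2 * s).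
  have -> : c' / (2 * s) = s^-1 * (c' / 2) by field; rewrite gt_eqF.
  rewrite expr2 invfM ler_pM2l ?invr_gt0//.
  have c20 : 0 < 2 / c' by rewrite divr_gt0.
  have : s^-1 <= (2 / c')^-1 by rewrite lef_pV2 ?posrE.
  by rewrite invf_div.
have h2 : c' / (4 * s) <= p (G t).
  have e2 : c' / (2 * s) = 2^-1 * (c' / s) by field; rewrite gt_eqF.
  have e4 : c' / (4 * s) = 4^-1 * (c' / s) by field; rewrite gt_eqF.
  by rewrite e4; move: h1 hsplit hu2; rewrite e2; lra.
apply: le_trans h2; rewrite powRN powR12_sqrt ?(ltW t0)// -mulrA -invfM.
rewrite ler_pM2l// lef_pV2 ?posrE ?mulr_gt0 ?sqrtr_gt0// -mulrA.
by rewrite ler_pM2l.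
Qed.

Lemma pr_first_passage_le_tmean : exists2 A, 0 < A & forall t, 0 < t ->
  p (G t) <= c^-1 * t `^ (- (g / 2)) +
    2 * c^-1 * t `^ (g / 2) * tmean P xiR (A * t `^ (- g)).
Proof.
have [A A0 hA] := tmean_zeta_le zeta_iid gamma0 gamma1 zeta_attr.
exists A => // t t0.
have Tg0 : 0 < t `^ g by rewrite powR_gt0.
(* [n <= t^g] bounds the sum of the [u k], and [t^g < n.+1] bounds [u n]. *)
pose n := Num.truncn (t `^ g).
have eT : t `^ (g / 2) = Num.sqrt (t `^ g) by rewrite powRrM powR12_sqrt// ltW.
have a0 := atrunc_ge0 zeta t0.
have m0 a : 0 <= a -> 0 <= tmean P xiR a.
  by move=> a0'; apply: Ex_ge0 => w; rewrite le_min ler01 mulr_ge0.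
apply: (le_trans (pr_first_passage_le xi_iid zeta_iid zeta_pos xi_zeta_indep n t0)).
apply: lerD.
  apply: (le_trans (pr_nonpos_le xi_iid xi_sym c0 n)).
  rewrite ler_pM2l ?invr_gt0// powRN lef_pV2 ?posrE ?powR_gt0 ?sqrtr_gt0//.
  by rewrite eT ler_sqrt// ltW// truncnS_gt.
apply: ler_pM.
- by apply: sumr_ge0 => k _; exact: pr_ge0.
- exact: m0.
- apply: (le_trans (sum_pr_nonpos_le xi_iid xi_sym c0 n)).
  rewrite ler_pM2l ?mulr_gt0 ?invr_gt0// eT ler_sqrt ?(ltW Tg0)//.
  by rewrite truncn_le// ltW.
- by apply: (tmean_ndecr P mX a0); exact: hA.
Qed.

Let powRhalf t : 0 < t -> t `^ (g / 2) * t `^ (- g) = t `^ (- (g / 2)).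
Proof.
move=> t0; rewrite -powRD; first by congr (_ `^ _); lra.
by apply/implyP => _; rewrite gt_eqF.
Qed.

Lemma pr_first_passage_le_gt1 : 1 < beta -> exists2 K, 0 < K & forall t, 0 < t ->
  p (G t) <= K * t `^ (- (g / 2)).
Proof.
move=> b1; have b0 : 0 < beta by lra.
have [A A0 hA] := pr_first_passage_le_tmean.
have [K1 K10 hK1] := tail_xi_le xi_attr b0.
have [C C0 hC] := tmean_le_gt1 mX b0 K10 hK1 b1.
exists (c^-1 + 2 * c^-1 * C * A).
  by rewrite addr_gt0 ?invr_gt0// !mulr_gt0// invr_gt0.
move=> t t0; apply: (le_trans (hA t t0)); rewrite [leRHS]mulrDl lerD2l.
have tg0 : 0 < A * t `^ (- g) by rewrite mulr_gt0// powR_gt0.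
have h2 : 0 <= 2 * c^-1 * t `^ (g / 2).
  by rewrite mulr_ge0 ?powR_ge0// mulr_ge0// invr_ge0 ltW.
apply: (le_trans (ler_wpM2l h2 (hC _ tg0))).
by rewrite -(powRhalf t0) le_eqVlt; apply/orP; left; apply/eqP; ring.
Qed.

Lemma pr_first_passage_le_eq1 : beta = 1 -> exists2 K, 0 < K & exists t0 : R,
  forall t, t0 <= t -> p (G t) <= K * ln t * t `^ (- (g / 2)).
Proof.
move=> b1; have b0 : 0 < beta by lra.
have [A A0 hA] := pr_first_passage_le_tmean.
have [K1 K10 hK1] := tail_xi_le xi_attr b0.
have [D D0 hD] := tmean_le_eq1 mX K10 hK1 b1.
(* Once [ln t >= 1], the three terms bound [2], [- D ln A] and [D g ln t] by multiples of [ln t],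
   using [g <= 1]. *)
pose M := 2 + D * `|ln A| + D.
have M0 : 0 < M.
  by rewrite /M addrAC ltr_wpDr ?addr_gt0// mulr_ge0// ltW.
have ci0 : 0 < c^-1 by rewrite invr_gt0.
exists (c^-1 + 2 * c^-1 * A * M); first by rewrite addr_gt0// !mulr_gt0.
(* The first threshold gives [ln t >= 1], the second [A t^(-g) <= 1], the range of
   [tmean_le_eq1]. *)
exists (Num.max (expR 1) (A `^ g^-1)) => t; rewrite ge_max => /andP[t1 t2].
have t0 : 0 < t by apply: lt_le_trans t1; rewrite expR_gt0.
have lt1 : 1 <= ln t by rewrite -[leLHS]expRK ler_ln ?posrE ?expR_gt0.
have Atg : A <= t `^ g.
  have eA : A = (A `^ g^-1) `^ g.
    by rewrite -powRrM (mulVf (lt0r_neq0 g0)) powRr1// ltW.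
  rewrite [leLHS]eA; apply: (ge0_ler_powR (ltW g0)) => //.
  - by rewrite nnegrE powR_ge0.
  - by rewrite nnegrE ltW.
have tg0 : 0 < t `^ (- g) by rewrite powR_gt0.
have a1 : 0 < A * t `^ (- g) <= 1.
  rewrite mulr_gt0//=; rewrite powRN ler_pdivrMr ?powR_gt0//.
  by rewrite mul1r.
apply: (le_trans (hA t t0)).
have h2 : 0 <= 2 * c^-1 * t `^ (g / 2).
  by rewrite mulr_ge0 ?powR_ge0// mulr_ge0// ltW.
apply: (le_trans (lerD (lexx _) (ler_wpM2l h2 (hD _ a1)))).
have hln : 2 - D * ln (A * t `^ (- g)) <= M * ln t.
  rewrite lnM ?posrE// ln_powR mulNr.
  have gl1 : g <= 1 by rewrite ge_min lexx.
  have : D * (g * ln t) <= D * ln t.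
    by rewrite ler_pM2l// ler_piMl//; lra.
  have : - (D * ln A) <= D * `|ln A| * ln t.
    rewrite -mulrN; apply: (@le_trans _ _ (D * `|ln A|)).
      by rewrite ler_pM2l// -normrN ler_norm.
    by rewrite ler_peMr// mulr_ge0// ltW.
  by rewrite /M; lra.
have h3 : 2 * c^-1 * t `^ (g / 2) * (A * t `^ (- g) * (2 - D * ln (A * t `^ (- g))))
    <= 2 * c^-1 * A * M * ln t * t `^ (- (g / 2)).
  apply: (@le_trans _ _ (2 * c^-1 * t `^ (g / 2) * (A * t `^ (- g) * (M * ln t)))).
    by apply: ler_wpM2l => //; apply: ler_wpM2l => //; rewrite mulr_ge0// ltW.
  by rewrite -(powRhalf t0) le_eqVlt; apply/orP; left; apply/eqP; ring.
apply: (le_trans (lerD (lexx _) h3)).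
rewrite [leRHS](_ : _ = c^-1 * t `^ (- (g / 2)) * ln t +
  2 * c^-1 * A * M * ln t * t `^ (- (g / 2))); last by ring.
by rewrite lerD2r ler_peMr// mulr_ge0 ?powR_ge0// ltW.
Qed.

Lemma pr_first_passage_ge : exists2 K, 0 < K & exists t0 : R,
  forall t, t0 <= t -> K * t `^ (- Num.min g 2^-1) <= p (G t).
Proof.
have [h|h] := leP 2^-1 g; first exact: pr_first_passage_ge_half.
have g1 : gamma < 1.
  by move: h; rewrite ltNge; apply: contraTT; rewrite -leNgt => /min_l ->; lra.
rewrite (min_r (ltW g1)).
have [K K0 [t0 hK]] := pr_zeta_gt_ge zeta_iid gamma0 zeta_pos zeta_attr g1.
exists (c * K); first exact: mulr_gt0.
exists t0 => t /hK ht; apply: le_trans (pr_first_passage_ge_step zeta_pos xi_zeta_indep t).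
by rewrite -mulrA ler_pM2l.
Qed.

End asymptotics.
Theorem corollary2p5 (R : realType) (d : measure_display)
    (T : measurableType d) (P : probability T R)
    (beta gamma : R)
    (xi : nat -> {RV P >-> int}) (zeta : int -> {RV P >-> R})
    (hbeta : 1 <= beta < 2)
    (hgamma : 0 < gamma <= 2) (hgamma1 : gamma != 1)
    (xi_iid : iid xi) (xi_sym : symmetric_rv (xi 0%N))
    (xi_attr : walk_attraction P beta (fun w => (xi 0%N w)%:~R))
    (zeta_iid : iid zeta)
    (zeta_pos : forall k : int, {ae P, forall w, 0 < zeta k w})
    (zeta_attr : medium_attraction P gamma zeta)
    (xi_zeta_indep : independent_families xi zeta) :
  let ghat := Num.min 1 gamma in
  exists K_low K_up : R -> R,
    [/\ 1 < gamma /\ beta != 1 ->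
          positive_constant K_low /\ positive_constant K_up,
        gamma < 1 \/ beta = 1 ->
          slowly_varying K_low /\ slowly_varying K_up &
        \forall t \near +oo,
          ((K_low t * t `^ (- Num.min ghat 2^-1))%:E
             <= P [set w | (t%:E < first_passage_time (fun n => xi n w)
                                                     (fun k => zeta k w))%E]
             <= (K_up t * t `^ (- (ghat / 2)))%:E)%E].
Proof.
have gamma0 : 0 < gamma by case/andP: hgamma.
have mG t := measurable_event xi zeta t.
have [Kl Kl0 [tl hl]] := pr_first_passage_ge xi_iid xi_sym xi_attr zeta_iid
  zeta_pos zeta_attr xi_zeta_indep gamma0.
move=> ghat; have [b1|b1] := eqVneq beta 1.
  have [Ku Ku0 [tu hu]] := pr_first_passage_le_eq1 xi_iid xi_sym xi_attr zeta_iid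
    zeta_pos zeta_attr xi_zeta_indep gamma0 hgamma1 b1.
  exists (fun=> Kl), (fun t => Ku * ln t); split=> [[_]//||].
    by move=> _; split; [exact: slowly_varying_cst|exact: slowly_varying_ln].
  apply: filterS (nbhs_pinfty_ge (num_real (Num.max tl tu))) => t.
  rewrite ge_max => /andP[htl htu].
  by rewrite (prE P (mG t)) !lee_fin hl// hu.
have b1' : 1 < beta by rewrite lt_neqAle eq_sym b1; case/andP: hbeta.
have [Ku Ku0 hu] := pr_first_passage_le_gt1 xi_iid xi_sym xi_attr zeta_iid
  zeta_pos zeta_attr xi_zeta_indep gamma0 hgamma1 b1'.
(* Away from beta = 1 constants work for every gamma; if gamma < 1 they count as slowly varying
   functions. *)
exists (fun=> Kl), (fun=> Ku); split.
- by move=> _; split; [exists Kl|exists Ku].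
- by move=> _; split; exact: slowly_varying_cst.
apply: filterS (nbhs_pinfty_ge (num_real (Num.max tl 1))) => t.
rewrite ge_max => /andP[htl ht1].
by rewrite (prE P (mG t)) !lee_fin hl//= hu// (lt_le_trans ltr01).
Qed.
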